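(* The second-order S-ESAV-CN scheme described in the context admits a unique solution: for every $n\ge1$, given $(\phi^{n-1},\psi^{n-1},B^{n-1})$ and $(\phi^n,\psi^n,B^n)$, the S-ESAV-CN equations have a unique solution $(\phi^{n+1},\psi^{n+1},B^{n+1})$. Moreover the scheme is unconditionally energy stable (i.e. for any time step $\Delta t>0$) in the sense that $$C\ln(B^{n+1})\le C\ln(B^n)\qquad\text{for any } n .$$
   Context: Let $\Omega$ be a domain in $\mathbb{R}^d$, $d\in\{1,2,3\}$, with periodic boundary conditions (e.g. a periodic box $[0,L]^d$). $(\cdot,\cdot)$ and $\|\cdot\|$ are the $L^2(\Omega)$ inner product and norm. $L^2_0(\Omega)=\{v\in L^2(\Omega):(v,1)=0\}$, and $H^2_{per}(\Omega)$ is the space of periodic $H^2$ functions. For $v\in L_0^2(\Omega)$, $-\Delta^{-1}v$ denotes the unique $\varphi\in H^2_{per}(\Omega)\cap L^2_0(\Omega)$ with $-\Delta\varphi=v$, and $\|v\|_{-1}=\|\nabla\varphi\|=\sqrt{(-\Delta^{-1}v,v)}$; this norm is applied to the functions $\psi^n$, which have zero mean by the mass conservation property of the scheme. Parameters: mobility constant $M>0$; $\alpha,\beta$ non-negative; $\epsilon\in(0,1)$; vacancy penalization parameter $h_{vac}\gg1$ (the value $h_{vac}=0$ corresponds to no vacancy potential); stabilization parameter $S>0$; fixed time step $\Delta t>0$. Nonlinearities: $F(\phi)=\frac14\phi^4-\frac{\epsilon}{2}\phi^2$, $F_{vac}(\phi)=\frac{h_{vac}}{3}(|\phi|^3-\phi^3)$,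 $f(\phi)=F'(\phi)=\phi^3-\epsilon\phi$, $f_{vac}(\phi)=F_{vac}'(\phi)=h_{vac}(|\phi|-\phi)\phi$. Pseudo energy: $$\widetilde E(\phi,\psi)=\int_\Omega\Big(\frac12(\Delta\phi)^2-|\nabla\phi|^2+\frac12\phi^2+F(\phi)+F_{vac}(\phi)\Big)dx+\frac{\alpha}{2M}\|\psi\|_{-1}^2 .$$ $C$ is a large positive constant with $C\ge \widetilde E(\phi^0,\psi^0)$. Notation for a sequence $(g^n)$: $g^{n+1/2}=\frac{g^{n+1}+g^n}{2}$, $g^{\dagger,n+1}=\frac32 g^n-\frac12 g^{n-1}$, $g^{\star,n+1}=2g^n-g^{n-1}$. S-ESAV-CN equations ($n\ge1$), with unknown functions $\phi^{n+1},\psi^{n+1}$ and scalar $B^{n+1}$: $$\alpha\frac{\psi^{n+1}-\psi^n}{\Delta t}+\beta\psi^{n+1/2}=M\Delta\mu^{n+1/2},$$ $$\mu^{n+1/2}=(\Delta+1)^2\phi^{n+1/2}+\xi^{n+1}\big(f(\phi^{\dagger,n+1})+f_{vac}(\phi^{\dagger,n+1})\big)+S(\phi^{n+1}-\phi^{\star,n+1}),$$ $$\psi^{n+1/2}=\frac{\phi^{n+1}-\phi^n}{\Delta t},\qquad \frac{B^{n+1}-B^n}{\Delta t}=-\frac{\beta B^{n+1}}{CM}\|\psi^{n+1/2}\|_{-1}^2,$$ $$\xi^{n+1}=\frac{B^{\dagger,n+1}}{\exp\big(\widetilde E(\phi^{\dagger,n+1},\psi^{\dagger,n+1})/C\big)}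 .$$ Initial data: $\phi^0$ given, $\psi^0=0$, $B^0=\exp\big(\widetilde E(\phi^0,\psi^0)/C\big)$, and $(\phi^1,\psi^1,B^1)$ is obtained from the first-order scheme $$\alpha\frac{\psi^1-\psi^0}{\Delta t}+\beta\psi^1=M\Delta\mu^1,\quad \mu^1=(\Delta+1)^2\phi^1+\xi^1\big(f(\phi^0)+f_{vac}(\phi^0)\big)+S(\phi^1-\phi^0),$$ $$\psi^1=\frac{\phi^1-\phi^0}{\Delta t},\quad \frac{B^1-B^0}{\Delta t}=-\frac{\beta B^1}{CM}\|\psi^1\|_{-1}^2,\quad \xi^1=\frac{B^0}{\exp\big(\widetilde E(\phi^0,\psi^0)/C\big)} .$$ *)

(* Defs.v *)
From HB Require Import structures.
From mathcomp Require Import all_boot all_order all_algebra.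
From mathcomp Require Import all_classical all_reals all_analysis.
Import Order.TTheory GRing.Theory Num.Theory.
Import numFieldNormedType.Exports.

Set Implicit Arguments.
Unset Strict Implicit.
Unset Printing Implicit Defensive.

Local Open Scope classical_set_scope.
Local Open Scope ring_scope.

(** * Lebesgue measure on a box of R^d *)

(* The Borel sigma-algebra of R^d, generated by the coordinate maps. *)
Section rV_measurable.
Context {R : realType} (d : nat).

Let coord (i : 'I_d) (x : 'rV[R]_d) : measurableTypeR R := x ord0 i.

Let rV_set0 : g_sigma_preimage coord set0.
Proof. exact: sigma_algebra0. Qed.

Let rV_setC A : g_sigma_preimage coord A -> g_sigma_preimage coord (~` A).
Proof. exact: sigma_algebraC. Qed.

Let rV_bigcup (F : (set 'rV[R]_d)^nat) :
  (forall i, g_sigma_preimage coord (F i)) ->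
  g_sigma_preimage coord (\bigcup_i (F i)).
Proof. exact: sigma_algebra_bigcup. Qed.

HB.instance Definition _ := @isMeasurable.Build default_measure_display
  'rV[R]_d (g_sigma_preimage coord) rV_set0 rV_setC rV_bigcup.

Lemma measurable_coord (i : 'I_d) :
  measurable_fun [set: 'rV[R]_d] (fun x : 'rV[R]_d => x ord0 i).
Proof.
move=> _ Y mY; rewrite setTI; apply: sub_sigma_algebra => /=.
rewrite -bigcup_seq/=; exists i => /=; first by rewrite mem_index_enum.
by exists Y => //; rewrite setTI.
Qed.

Lemma measurable_rVP d' (T : measurableType d') (f : T -> 'rV[R]_d) :
  (forall i, measurable_fun [set: T] (fun t => f t ord0 i : measurableTypeR R)) ->
  measurable_fun [set: T] f.
Proof.
move=> mf; apply: (@measurability _ _ _ _ _ _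
  (\big[setU/set0]_(i < d) preimage_set_system setT (coord i) measurable)) => //.
move=> _ [B + <-]; rewrite -bigcup_seq => -[i _] [A mA <-].
by rewrite setTI; have := mf i measurableT A mA.
Qed.

End rV_measurable.

(* (t, (x_0, ..., x_(d-1))) |-> (t, x_0, ..., x_(d-1)) *)
Definition rV_cons {R : realType} {d : nat} (p : measurableTypeR R * 'rV[R]_d) :
  'rV[R]_d.+1 := row_mx (p.1 : R)%:M p.2.

Lemma rV_cons0 {R : realType} {d : nat} (p : measurableTypeR R * 'rV[R]_d) :
  rV_cons p ord0 ord0 = p.1.
Proof.
by rewrite /rV_cons mxE; case: splitP => // k _; rewrite mxE !ord1 mulr1n.
Qed.

Lemma rV_consS {R : realType} {d : nat} (p : measurableTypeR R * 'rV[R]_d)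
  (i : 'I_d) : rV_cons p ord0 (lift ord0 i) = p.2 ord0 i.
Proof.
rewrite /rV_cons mxE; case: splitP => [k|k /eqP]; first by rewrite ord1.
by rewrite eqSS => /eqP/val_inj <-.
Qed.

Lemma measurable_rV_cons {R : realType} {d : nat} :
  measurable_fun [set: measurableTypeR R * 'rV[R]_d] (@rV_cons R d).
Proof.
apply: measurable_rVP => i.
have [j ->|->] := unliftP ord0 i.
  under eq_fun do rewrite rV_consS.
  exact: (measurableT_comp (measurable_coord j)).
under eq_fun do rewrite rV_cons0.
exact: measurable_fst.
Qed.

Section lebesgue_itv0.
Context {R : realType} (l : R).

Definition lebesgue_itv0 : set (measurableTypeR R) -> \bar R :=
  mrestr lebesgue_measure (measurable_itv `[0, l]).

HB.instance Definition _ := Measure.on lebesgue_itv0.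

Let lebesgue_itv0_fin : fin_num_fun lebesgue_itv0.
Proof.
move=> A mA; rewrite ge0_fin_numE ?measure_ge0//.
apply: (@le_lt_trans _ _ (lebesgue_measure `[0%R, l]%classic)).
  apply: le_measure; rewrite ?inE; [exact: measurableI|exact: measurable_itv|].
  exact: subIsetr.
by rewrite lebesgue_measure_itv/=; case: ifP => _; rewrite ltry.
Qed.

HB.instance Definition _ :=
  Measure_isFinite.Build _ _ _ lebesgue_itv0 lebesgue_itv0_fin.

End lebesgue_itv0.

Section box_cons.
Context {R : realType} {d : nat}.
Variables (l : R) (m : {finite_measure set 'rV[R]_d -> \bar R}).

Definition box_cons : set 'rV[R]_d.+1 -> \bar R :=
  pushforward (lebesgue_itv0 l \x m)%E rV_cons.

HB.instance Definition _ := Measure.copy box_cons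
  (measure_function_pushforward__canonical__measure_function_Measure _ measurable_rV_cons).

Let box_cons_fin : fin_num_fun box_cons.
Proof.
move=> A mA; rewrite ge0_fin_numE ?measure_ge0//.
apply: (@le_lt_trans _ _ (box_cons setT)).
  by apply: le_measure; rewrite ?inE.
have -> : box_cons setT = (lebesgue_itv0 l setT * m setT)%E.
  by rewrite -product_measure1E// setXTT.
by rewrite lte_mul_pinfty// ?fin_num_measure// ltey_eq fin_num_measure.
Qed.

HB.instance Definition _ := Measure_isFinite.Build _ _ _ box_cons box_cons_fin.

End box_cons.

(* Lebesgue measure on the box [0, L_0] x ... x [0, L_(d-1)], extended by 0 to
   a measure on R^d; box_measureE characterises it. *)
Fixpoint box_measure (R : realType) (d : nat) :
    ('I_d -> R) -> {finite_measure set 'rV[R]_d -> \bar R} :=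
  match d with
  | 0 => fun _ => \d_(0 : 'rV[R]_0)
  | d'.+1 => fun L => box_cons (L ord0) (box_measure (L \o lift ord0))
  end.

Lemma box_measureE (R : realType) (d : nat) (L : 'I_d -> R)
    (A : 'I_d -> set (measurableTypeR R)) : (forall i, measurable (A i)) ->
  box_measure L [set x | forall i, A i (x ord0 i)] =
  (\prod_(i < d) lebesgue_measure (A i `&` `[0%R, L i]%classic))%E.
Proof.
elim: d L A => [|d IHd] L A mA.
  by rewrite big_ord0 /= diracE mem_set//= => i; case: (ltn_ord i).
rewrite big_ord_recl /= -IHd//.
rewrite -[X in (X * _)%E]/(lebesgue_itv0 (L ord0) (A ord0)).
rewrite -product_measure1E//; last first.
  rewrite [X in measurable X](_ : _ =
      \bigcap_(i in [set: 'I_d]) ((fun x : 'rV[R]_d => x ord0 i) @^-1` A (lift ord0 i))).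
    apply: fin_bigcap_measurable => // i _.
    by have := measurable_coord i measurableT (mA (lift ord0 i)); rewrite setTI.
  by apply/seteqP; split => x /= Ax i; [move=> _|]; exact: (Ax i).
rewrite /box_cons /pushforward; congr (product_measure1 _ _ _).
apply/seteqP; split => -[t x] /=.
  move=> Ax; split; first by have := Ax ord0; rewrite rV_cons0.
  by move=> i; have := Ax (lift ord0 i); rewrite rV_consS.
move=> [At Ax] i; have [j ->|->] := unliftP ord0 i; first by rewrite rV_consS.
by rewrite rV_cons0.
Qed.

(** * Periodic Sobolev spaces on the box *)

(* Functions on the torus are represented by functions on R^d of which only the
   values on the box matter (up to a null set); periodicity is carried by the
   test functions, which are smooth and L-periodic on the whole of R^d and not
   required to vanish near the boundary of the box. *)
Section periodic_sobolev.
Context {R : realType} {d : nat}.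
Variable L : 'I_d -> R.
Local Notation mu := (box_measure L).
Implicit Types (u v g eta : 'rV[R]_d -> R) (s : seq 'I_d).

Definition partials s eta : 'rV[R]_d -> R :=
  foldr (fun i g => 'D_(delta_mx ord0 i) g) eta s.

Definition smooth eta := forall s x, differentiable (partials s eta) x.

Definition periodic eta :=
  forall i x, eta (x + L i *: delta_mx ord0 i) = eta x.

Definition L2 u : Prop := u \in Lfun mu 2%:E.

Definition L2_0 u := L2 u /\ \int[mu]_x u x = 0.

Definition is_weak_deriv s u g := forall eta, smooth eta -> periodic eta ->
  \int[mu]_x (u x * partials s eta x) =
  (-1) ^+ size s * \int[mu]_x (g x * eta x).

Definition Hper (k : nat) u := L2 u /\
  forall s, (size s <= k)%N -> exists2 g, L2 g & is_weak_deriv s u g.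

(* Unique up to a null set when it exists; arbitrary otherwise. *)
Definition weak_deriv s u : 'rV[R]_d -> R :=
  get [set g | L2 g /\ is_weak_deriv s u g].

Definition lap u : 'rV[R]_d -> R := fun x => \sum_(i < d) weak_deriv [:: i; i] u x.

Definition grad_sq u : 'rV[R]_d -> R :=
  fun x => \sum_(i < d) weak_deriv [:: i] u x ^+ 2.

Definition neg_lap_inv v : 'rV[R]_d -> R :=
  get [set w | [/\ Hper 2 w, L2_0 w & (fun x => - lap w x) = v %[ae mu]]].

Definition norm_m1 v : R := Num.sqrt (\int[mu]_x grad_sq (neg_lap_inv v) x).

(* The operator Delta + 1. *)
Definition lap1 u : 'rV[R]_d -> R := fun x => lap u x + u x.

End periodic_sobolev.

(** * The S-ESAV-CN scheme *)

Section scheme.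
Context {R : realType} {d : nat}.
Variables (L : 'I_d -> R) (M alpha beta eps hvac S dt C : R).
Local Notation mu := (box_measure L).

Definition Fpot (y : R) : R := y ^+ 4 / 4 - eps / 2 * y ^+ 2.
Definition Fvac (y : R) : R := hvac / 3 * (`|y| ^+ 3 - y ^+ 3).
Definition fpot (y : R) : R := y ^+ 3 - eps * y.
Definition fvac (y : R) : R := hvac * (`|y| - y) * y.

Definition pseudo_energy (phi psi : 'rV[R]_d -> R) : R :=
  \int[mu]_x (2^-1 * lap L phi x ^+ 2 - grad_sq L phi x + 2^-1 * phi x ^+ 2
              + Fpot (phi x) + Fvac (phi x))
  + alpha / (2 * M) * norm_m1 L psi ^+ 2.

Record state := State {
  phi_of : 'rV[R]_d -> R;
  psi_of : 'rV[R]_d -> R;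
  B_of : R }.

(* psi has zero mean, as needed for norm_m1 to make sense; the equations force
   this only when alpha + beta > 0. *)
Definition admissible (a : state) := Hper L 2 (phi_of a) /\ L2_0 L (psi_of a).

Definition state_ae_eq (a b : state) :=
  [/\ phi_of a = phi_of b %[ae mu], psi_of a = psi_of b %[ae mu]
    & B_of a = B_of b].

(* The equations at step n >= 1, for a0, a1, a2 the states at n-1, n, n+1.
   phi^{n+1/2} is required to be in H^4_per and mu^{n+1/2} in H^2_per, so that
   every differential operator below acts on its domain. *)
Definition sesav_cn_step (a0 a1 a2 : state) : Prop :=
  let phi_half x := (phi_of a2 x + phi_of a1 x) / 2 in
  let psi_half x := (psi_of a2 x + psi_of a1 x) / 2 in
  let phi_dag x := 3 / 2 * phi_of a1 x - 1 / 2 * phi_of a0 x in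
  let psi_dag x := 3 / 2 * psi_of a1 x - 1 / 2 * psi_of a0 x in
  let B_dag := 3 / 2 * B_of a1 - 1 / 2 * B_of a0 in
  let phi_star x := 2 * phi_of a1 x - phi_of a0 x in
  let xi := B_dag / expR (pseudo_energy phi_dag psi_dag / C) in
  let mu_half x := lap1 L (lap1 L phi_half) x
    + xi * (fpot (phi_dag x) + fvac (phi_dag x))
    + S * (phi_of a2 x - phi_star x) in
  [/\ Hper L 4 phi_half,
      Hper L 2 mu_half,
      {ae mu, forall x, alpha * ((psi_of a2 x - psi_of a1 x) / dt)
                        + beta * psi_half x = M * lap L mu_half x},
      {ae mu, forall x, psi_half x = (phi_of a2 x - phi_of a1 x) / dt}
    & (B_of a2 - B_of a1) / dt
      = - (beta * B_of a2 / (C * M)) * norm_m1 L psi_half ^+ 2].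

Definition initial_state (phi0 : 'rV[R]_d -> R) : state :=
  State phi0 (fun=> 0) (expR (pseudo_energy phi0 (fun=> 0) / C)).

Definition sesav_first_step (a0 a1 : state) : Prop :=
  let xi := B_of a0 / expR (pseudo_energy (phi_of a0) (psi_of a0) / C) in
  let mu1 x := lap1 L (lap1 L (phi_of a1)) x
    + xi * (fpot (phi_of a0 x) + fvac (phi_of a0 x))
    + S * (phi_of a1 x - phi_of a0 x) in
  [/\ Hper L 4 (phi_of a1),
      Hper L 2 mu1,
      {ae mu, forall x, alpha * ((psi_of a1 x - psi_of a0 x) / dt)
                        + beta * psi_of a1 x = M * lap L mu1 x},
      {ae mu, forall x, psi_of a1 x = (phi_of a1 x - phi_of a0 x) / dt}
    & (B_of a1 - B_of a0) / dt
      = - (beta * B_of a1 / (C * M)) * norm_m1 L (psi_of a1) ^+ 2].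

Definition sesav_cn_sequence (phi0 : 'rV[R]_d -> R) (a : nat -> state) :=
  [/\ a 0 = initial_state phi0,
      forall n, admissible (a n),
      sesav_first_step (a 0) (a 1)
    & forall n, (1 <= n)%N -> sesav_cn_step (a n.-1) (a n) (a n.+1)].

End scheme.

Arguments state : clear implicits.

(* Main.v *)
(* Unique solvability is proved mode by mode, with a real Fourier basis of the
   box. A function with two weak derivatives in L^2 is bounded when d <= 3, so
   the explicit nonlinear term is in L^2 and the step is linear in
   w = phi^{n+1/2}. On the mode of frequency k it reads D w_k = num_k, where,
   with l = |k|^2, D = c + M l ((1 - l)^2 + 2 S) and c >= 0. For k <> 0 this is
   positive and grows like l^3, whence a unique solution in H^4; the mean mode is
   determined by the zero-mean condition on psi^{n+1}. The equation for B^{n+1}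
   is B^{n+1} (1 + dt beta |psi^{n+1/2}|_{-1}^2 / (C M)) = B^n, which is uniquely
   solvable and gives 0 < B^{n+1} <= B^n as soon as B^n > 0. *)
Require Import Defs.
From HB Require Import structures.
From mathcomp Require Import all_boot all_order all_algebra.
From mathcomp Require Import all_classical all_reals all_analysis.
From mathcomp Require Import measurable_realfun.
From mathcomp Require Import ring lra zify.
Import Order.TTheory GRing.Theory Num.Theory.
Import numFieldNormedType.Exports.
Set Implicit Arguments.
Unset Strict Implicit.
Unset Printing Implicit Defensive.

Local Open Scope classical_set_scope.
Local Open Scope ring_scope.

(** * Square-integrable functions *)

(** The datum phi^n lies only in H^2, whereas (Delta + 1)^2 needs H^4. This is why the unknown is
    the half-step function w; phi^{n+1} = 2 w - phi^n and psi^{n+1} = 4 (w - phi^n) / dt - psi^n are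
    recovered from it with the regularity of the data. The substitution turns S phi^{n+1} into 2 S
    w, whence the 2 S in D, and gives c = 2 q / dt with q = 2 alpha / dt + beta. Since c may vanish
    and (1 - l)^2 vanishes at l = 1, it is S > 0 that bounds D below by a multiple of l (1 + l)^2.
    The part of num_k without a factor l is absorbed by the spectral gap of the Laplacian on the
    box.

    Working mode by mode requires that a weak derivative be recognised from its coefficients alone.
    Parseval's identity gives this, and it rests on completeness of the basis, obtained by measure
    theory: an integrable function orthogonal to all waves has zero integral over every measurable
    set. *)

Section finite_measure_L2.
Context {disp : measure_display} {T : measurableType disp} {R : realType}.
Variable mu : {finite_measure set T -> \bar R}.
Implicit Types (u v w f g : T -> R) (a b c r : R).
Local Notation intg f := (mu.-integrable setT (EFin \o f)).
Local Notation sqi u := (u \in Lfun mu 2%:E).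

Lemma intg_measurable f : intg f -> measurable_fun setT f.
Proof. by move=> /(measurable_int mu) /measurable_EFinP. Qed.

Lemma eq_intg f g : f =1 g -> intg f -> intg g.
Proof. by move=> /funext ->. Qed.

Lemma intgD f g : intg f -> intg g -> intg (fun x => f x + g x).
Proof. by move=> fi gi; exact: (integrableD measurableT fi gi). Qed.

Lemma intgZ c f : intg f -> intg (fun x => c * f x).
Proof. by move=> fi; exact: (integrableZl measurableT c fi). Qed.

Lemma intg_cst c : intg (fun=> c).
Proof. exact: (finite_measure_integrable_cst mu). Qed.

Lemma intg_le f g : measurable_fun setT f -> (forall x, `|f x| <= g x) ->
  intg g -> intg f.
Proof.
move=> mf fg gi; apply: (le_integrable measurableT _ _ gi).
  exact/measurable_EFinP.
by move=> x _ /=; rewrite lee_fin (le_trans (fg x))// ler_norm.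
Qed.

Lemma intg_bounded f c : measurable_fun setT f -> (forall x, `|f x| <= c) ->
  intg f.
Proof. by move=> mf fc; apply: (intg_le mf fc); exact: intg_cst. Qed.

Lemma intgM_bounded f g c : intg f -> measurable_fun setT g ->
  (forall x, `|g x| <= c) -> intg (fun x => f x * g x).
Proof.
move=> fi mg gc; apply: (@intg_le _ (fun x => c * `|f x|)).
- by apply: measurable_funM => //; exact: intg_measurable.
- by move=> x; rewrite normrM mulrC ler_wpM2r.
- by apply: intgZ; exact: (integrable_norm fi).
Qed.

Lemma intg_sum (I : Type) (s : seq I) (F : I -> T -> R) :
  (forall i, intg (F i)) -> intg (fun x => \sum_(i <- s) F i x).
Proof.
move=> Fi; elim: s => [|i s IHs].
  by apply: eq_intg (intg_cst 0) => x; rewrite big_nil.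
by apply: eq_intg (intgD (Fi i) IHs) => x; rewrite big_cons.
Qed.

Lemma Rintegral_sum (I : Type) (s : seq I) (F : I -> T -> R) :
  (forall i, intg (F i)) ->
  \int[mu]_x (\sum_(i <- s) F i x) = \sum_(i <- s) \int[mu]_x F i x.
Proof.
move=> Fi; elim: s => [|i s IHs].
  rewrite big_nil; under eq_Rintegral do rewrite big_nil.
  by rewrite Rintegral_cst// mul0r.
rewrite big_cons -IHs -RintegralD//; last exact: intg_sum.
by apply: eq_Rintegral => x _; rewrite big_cons.
Qed.

Lemma ae_eq_Rintegral f g : measurable_fun setT f -> measurable_fun setT g ->
  f = g %[ae mu] -> \int[mu]_x f x = \int[mu]_x g x.
Proof.
move=> mf mg fg; congr fine; apply: ae_eq_integral => //.
- exact/measurable_EFinP.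
- exact/measurable_EFinP.
- by apply: filterS fg => x /= + _ => ->.
Qed.

Lemma Rintegral_eq0_ae f : intg f -> (forall x, 0 <= f x) ->
  \int[mu]_x f x = 0 -> {ae mu, forall x, f x = 0}.
Proof.
move=> fi f0 If0.
have : (\int[mu]_x `|(EFin \o f) x| = 0)%E.
  under eq_integral do rewrite /= ger0_norm//.
  rewrite -[LHS]fineK; first by rewrite -[X in X%:E = _]/(\int[mu]_x f x) If0.
  exact: (integrable_fin_num measurableT fi).
move/(ae_eq_integral_abs mu measurableT (measurable_int mu fi)).
by apply: filterS => x /= /(_ Logic.I) [].
Qed.

Lemma sqiP u : sqi u <-> measurable_fun setT u /\ intg (fun x => u x ^+ 2).
Proof.
split=> [/[dup] /Lfun2_integrable_sqr ui|[mu_ ui]].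
  by rewrite inE => /andP[/[!inE]/= mu_ _]; split.
rewrite inE; apply/andP; split; rewrite inE//= /finite_norm unlock /Lnorm.
apply: poweR_lty; have /integrableP[_] := ui.
congr (_ < _)%E.
by apply: eq_integral => x _; rewrite /= normrX powR_mulrn.
Qed.

Lemma sqi_measurable u : sqi u -> measurable_fun setT u.
Proof. by move=> /sqiP[]. Qed.

Lemma sqi_sqr u : sqi u -> intg (fun x => u x ^+ 2).
Proof. by move=> /sqiP[]. Qed.

Lemma sqi_mul u v : sqi u -> sqi v -> intg (fun x => u x * v x).
Proof. by move=> ui vi; have /Lfun1_integrable := Lfun2_mul_Lfun1 ui vi. Qed.

Lemma sqiD u v : sqi u -> sqi v -> sqi (fun x => u x + v x).
Proof.
move=> /[dup] ui /sqiP[mu_ uui] /[dup] vi /sqiP[mv vvi]; apply/sqiP; split.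
  exact: measurable_funD.
apply: eq_intg (intgD (intgD uui (intgZ 2 (sqi_mul ui vi))) vvi) => x /=; ring.
Qed.

Lemma sqiZ c u : sqi u -> sqi (fun x => c * u x).
Proof.
move=> /sqiP[mu_ uui]; apply/sqiP; split; first exact: measurable_funM.
by apply: eq_intg (intgZ (c ^+ 2) uui) => x /=; ring.
Qed.

Lemma sqiN u : sqi u -> sqi (fun x => - u x).
Proof.
by move=> ui; rewrite (_ : (fun x => _) = fun x => -1 * u x) ?sqiZ//; apply: funext => x; ring.
Qed.

Lemma sqiB u v : sqi u -> sqi v -> sqi (fun x => u x - v x).
Proof. by move=> ui /sqiN; exact: sqiD. Qed.

Lemma sqi_bounded u c : measurable_fun setT u -> (forall x, `|u x| <= c) -> sqi u.
Proof.
move=> mu_ uc; apply/sqiP; split=> //; apply: (@intg_bounded _ (c ^+ 2)).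
  exact: measurable_funX.
move=> x; rewrite normrX ler_sqr ?nnegrE//.
exact: le_trans (uc x).
Qed.

Lemma sqi_cst c : sqi (fun=> c).
Proof. exact: (@sqi_bounded _ `|c|). Qed.

Lemma sqi_sum (I : Type) (s : seq I) (F : I -> T -> R) :
  (forall i, sqi (F i)) -> sqi (fun x => \sum_(i <- s) F i x).
Proof.
move=> Fi; elim: s => [|i s IHs].
  rewrite [X in X \in _](_ : _ = fun=> 0); first exact: sqi_cst.
  by apply: funext => x; rewrite big_nil.
rewrite [X in X \in _](_ : _ = fun x => F i x + \sum_(j <- s) F j x).
  exact: sqiD.
by apply: funext => x; rewrite big_cons.
Qed.

Lemma sqi_intg u : sqi u -> intg u.
Proof.
by move=> /sqi_mul /(_ (sqi_cst 1)); apply: eq_intg => x; rewrite mulr1.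
Qed.

(** The bound is only almost everywhere because functions on R^d are controlled on the box alone,
    which has full measure. *)
Lemma sqi_ae_bounded u c : measurable_fun setT u ->
  {ae mu, forall x, `|u x| <= c} -> sqi u.
Proof.
move=> mu_ uc; apply/sqiP; split=> //.
apply/integrableP; split; first exact/measurable_EFinP/measurable_funX.
apply: (@le_lt_trans _ _ (\int[mu]_x (c ^+ 2)%:E)%E).
  apply: ae_ge0_le_integral => //.
  - apply/measurable_EFinP; apply: measurableT_comp => //.
    exact: measurable_funX.
  - by move=> x _; rewrite lee_fin sqr_ge0.
  - apply: filterS uc => x /= ucx _; rewrite lee_fin normrX ler_sqr ?nnegrE//.
    exact: le_trans ucx.
by rewrite integral_cst// lte_mul_pinfty// ?lee_fin ?sqr_ge0// ltey_eq fin_num_measure.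
Qed.

Definition ip u v := \int[mu]_x (u x * v x).

Lemma ipC u v : ip u v = ip v u.
Proof. by apply: eq_Rintegral => x _; rewrite mulrC. Qed.

Lemma ipDl u v w : sqi u -> sqi v -> sqi w ->
  ip (fun x => u x + v x) w = ip u w + ip v w.
Proof.
move=> ui vi wi; rewrite /ip -RintegralD//; try exact: sqi_mul.
by apply: eq_Rintegral => x _; rewrite mulrDl.
Qed.

Lemma ipZl c u w : sqi u -> sqi w -> ip (fun x => c * u x) w = c * ip u w.
Proof.
move=> ui wi; rewrite /ip -RintegralZl//; last exact: sqi_mul.
by apply: eq_Rintegral => x _; rewrite mulrA.
Qed.

Lemma ipNl u w : sqi u -> sqi w -> ip (fun x => - u x) w = - ip u w.
Proof.
move=> ui wi; rewrite -mulN1r -ipZl//.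
by apply: eq_Rintegral => x _; rewrite mulN1r.
Qed.

Lemma ipBl u v w : sqi u -> sqi v -> sqi w ->
  ip (fun x => u x - v x) w = ip u w - ip v w.
Proof. by move=> ui vi wi; rewrite ipDl ?ipNl//; exact: sqiN. Qed.

Lemma ip_suml (I : Type) (s : seq I) (F : I -> T -> R) w :
  (forall i, sqi (F i)) -> sqi w ->
  ip (fun x => \sum_(i <- s) F i x) w = \sum_(i <- s) ip (F i) w.
Proof.
move=> Fi wi; rewrite /ip -Rintegral_sum; last by move=> i; exact: sqi_mul.
by apply: eq_Rintegral => x _; rewrite mulr_suml.
Qed.

Lemma ip_ge0 u : 0 <= ip u u.
Proof. by apply: Rintegral_ge0 => x _; rewrite -expr2 sqr_ge0. Qed.

Lemma ip_eq0 u : sqi u -> ip u u = 0 -> {ae mu, forall x, u x = 0}.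
Proof.
move=> ui /Rintegral_eq0_ae uu; have := uu (sqi_mul ui ui).
move=> /(_ (fun x => sqr_ge0 (u x))); apply: filterS => x /eqP.
by rewrite mulf_eq0 orbb => /eqP.
Qed.

Lemma ip_ae u v w : sqi u -> sqi v -> sqi w -> u = v %[ae mu] -> ip u w = ip v w.
Proof.
move=> ui vi wi uv; apply: ae_eq_Rintegral.
- by apply: measurable_funM; exact: sqi_measurable.
- by apply: measurable_funM; exact: sqi_measurable.
- by apply: filterS uv => x /= + xT => ->.
Qed.

Lemma ipBB u v : sqi u -> sqi v ->
  ip (fun x => u x - v x) (fun x => u x - v x) = ip u u - 2 * ip u v + ip v v.
Proof.
move=> ui vi; rewrite ipBl//; last exact: sqiB.
rewrite ![ip _ (fun x => u x - v x)]ipC !ipBl// (ipC v u); ring.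
Qed.

Lemma cauchy_schwarz u v : sqi u -> sqi v -> ip u v ^+ 2 <= ip u u * ip v v.
Proof.
move=> ui vi; have pos c : 0 <= ip u u - 2 * (c * ip u v) + c ^+ 2 * ip v v.
  have -> : ip u u - 2 * (c * ip u v) + c ^+ 2 * ip v v =
      ip (fun x => u x - c * v x) (fun x => u x - c * v x).
    have cvi := sqiZ c vi.
    by rewrite ipBB// ipZl// ![ip _ (fun x => c * v x)]ipC !ipZl// (ipC v u); ring.
  exact: ip_ge0.
have [vv0|vv0] := eqVneq (ip v v) 0.
  rewrite vv0 mulr0; have [->|uv0] := eqVneq (ip u v) 0; first by rewrite expr0n.
  (* When [ip v v = 0] the quadratic is affine in its parameter; at this value it equals -1. *)
  have := pos ((ip u u + 1) / (2 * ip u v)); rewrite vv0 mulr0 addr0.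
  rewrite (_ : 2 * (_ * ip u v) = ip u u + 1); last by field.
  by move=> ?; exfalso; lra.
have vvp : 0 < ip v v by rewrite lt_neqAle eq_sym vv0 ip_ge0.
(* The quadratic at its minimiser [ip u v / ip v v], multiplied by [ip v v]. *)
rewrite -subr_ge0 (_ : _ - _ = (ip u u - 2 * (ip u v / ip v v * ip u v)
  + (ip u v / ip v v) ^+ 2 * ip v v) * ip v v); last by field.
by rewrite mulr_ge0 ?ip_ge0.
Qed.

End finite_measure_L2.

(** * Completeness of L^2 *)

Section finite_measure_L2_complete.
Context {disp : measure_display} {T : measurableType disp} {R : realType}.
Variable mu : {finite_measure set T -> \bar R}.
Implicit Types (u v w f g : T -> R) (a b c r : R).
Local Notation intg f := (mu.-integrable setT (EFin \o f)).
Local Notation sqi u := (u \in Lfun mu 2%:E).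
Local Notation ip := (ip mu).

(** By monotone convergence the sum of the absolute increments has integral at most [c], so it is
    finite almost everywhere; there the telescoping series converges absolutely. *)
Lemma ae_cvgn_summable_increments (t : nat -> T -> R) (c : R) : 0 <= c ->
  (forall j, measurable_fun setT (t j)) ->
  (forall j, intg (fun x => `|t j.+1 x - t j x|)) ->
  (forall j, \int[mu]_x `|t j.+1 x - t j x| <= c / (2 ^ j.+1)%:R) ->
  exists2 A : set T, measurable A /\ mu (~` A) = 0%E &
    forall x, A x -> cvgn (t ^~ x).
Proof.
move=> c0 mt ti tc.
pose F j x : \bar R := (`|t j.+1 x - t j x|)%:E.
pose G x : \bar R := (\sum_(j <oo) F j x)%E.
have mF j : measurable_fun setT (F j).
  by apply/measurable_EFinP; exact: (intg_measurable (ti j)).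
have F0 j x : (0 <= F j x)%E by rewrite lee_fin.
have mG : measurable_fun setT G.
  by apply: ge0_emeasurable_sum => // k x _ _; exact: F0.
have IG : (\int[mu]_x G x <= c%:E)%E.
  rewrite integral_nneseries//.
  apply: le_trans (epsilon_trick0 xpredT c0).
  apply: lee_nneseries => [j _ _|j _]; first by apply: integral_ge0.
  have := tc j; rewrite -lee_fin; apply: le_trans.
  by rewrite fineK// (integrable_fin_num measurableT (ti j)).
have G0 x : (0 <= G x)%E by apply: nneseries_ge0 => j _ _; exact: F0.
have Gi : mu.-integrable setT G.
  apply/integrableP; split => //.
  under eq_integral do rewrite gee0_abs//.
  by rewrite (le_lt_trans IG)// ltry.
have mA : measurable [set x | G x < +oo]%E.
  rewrite [X in measurable X](_ : _ = setT `&` [set x | G x < +oo]%E); last by rewrite setTI.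
  exact: (emeasurable_fun_infty_o measurableT mG).
exists [set x | G x < +oo]%E.
  split=> //; apply/negligibleP; first exact: measurableC.
  apply: negligibleS (integrable_ae measurableT Gi) => x /=.
  by apply: contra_not => /(_ Logic.I); rewrite ge0_fin_numE.
move=> x /= Gx.
have cs : cvgn (series (telescope (t ^~ x))).
  apply: normed_cvg; apply: nondecreasing_is_cvgn.
    apply/nondecreasing_seqP => n; rewrite /series /= [leRHS]big_nat_recr//=.
    by rewrite lerDl.
  exists (fine (G x)) => _ [n _ <-].
  rewrite -lee_fin fineK ?ge0_fin_numE// /series /= -sumEFin.
  exact: nneseries_lim_ge.
rewrite (_ : t ^~ x = (fun n => t 0 x + series (telescope (t ^~ x)) n)).
  by apply: is_cvgD => //; exact: is_cvg_cst.
by apply: funext => n; exact: (eq_sum_telescope (t ^~ x)).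
Qed.

(* Riesz-Fischer: a rapidly Cauchy subsequence converges a.e., and Fatou's lemma
   turns the Cauchy condition into convergence to the pointwise limit. *)
Lemma sqi_complete (s : nat -> T -> R) : (forall n, sqi (s n)) ->
  (forall e, 0 < e -> exists N, forall m n, (N <= m)%N -> (N <= n)%N ->
     ip (fun x => s m x - s n x) (fun x => s m x - s n x) <= e) ->
  exists2 u, sqi u &
    forall e, 0 < e -> exists N, forall n, (N <= n)%N ->
      ip (fun x => s n x - u x) (fun x => s n x - u x) <= e.
Proof.
move=> si cauchy_s.
pose p (j : nat) : R := (2 ^ j.+1)%:R.
have p0 j : 0 < p j by rewrite ltr0n expn_gt0.
have p1 j : 1 <= p j by rewrite ler1n expn_gt0.
have [N0 N0P] := choice (fun j => cauchy_s ((p j) ^- 2) (ltac:(by rewrite invr_gt0 exprn_gt0))).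
(* The sum dominates every [N0 i] with [i <= j], and the summand [j] makes the indices tend to
   infinity. *)
pose n_ j := (\sum_(i < j.+1) N0 i + j)%N.
have N0n i j : (i <= j)%N -> (N0 i <= n_ j)%N.
  move=> ij; rewrite /n_ (bigD1 (Ordinal (ltac:(by []) : (i < j.+1)%N)))//=.
  by rewrite -!addnA leq_addr.
have nj j : (j <= n_ j)%N by rewrite leq_addl.
pose t j := s (n_ j).
have ti j : sqi (t j) by exact: si.
have dti j : sqi (fun x => t j.+1 x - t j x) by exact: sqiB.
have [A [mA muA] Acvg] : exists2 A : set T, measurable A /\ mu (~` A) = 0%E &
    forall x, A x -> cvgn (t ^~ x).
  apply: (@ae_cvgn_summable_increments t (fine (mu setT) + 1)).
  - by rewrite addr_ge0// fine_ge0.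
  - by move=> j; exact: (sqi_measurable (ti j)).
  - by move=> j; exact: (integrable_norm (sqi_intg (dti j))).
  move=> j; have dd := N0P j _ _ (N0n j j.+1 (leqnSn j)) (N0n j j (leqnn j)).
  (* The inequality |y| <= 1/p + p y^2 turns a squared norm at most p^-2 into an L^1 norm at most
     (mu(T) + 1) / p. *)
  apply: (@le_trans _ _ (\int[mu]_x ((p j)^-1 + p j * (t j.+1 x - t j x) ^+ 2))).
    apply: le_Rintegral => //.
    - exact: (integrable_norm (sqi_intg (dti j))).
    - apply: intgD; first exact: intg_cst.
      by apply: intgZ; exact: (sqi_sqr (dti j)).
    move=> x _; set y := t j.+1 x - t j x.
    have yy : y ^+ 2 = `|y| ^+ 2 by rewrite -normrX ger0_norm// sqr_ge0.
    rewrite -(ler_pM2l (p0 j)) yy mulrDr divff ?gt_eqF//.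
    have := sqr_ge0 (p j * `|y| - 1).
    have := mulr_ge0 (ltW (p0 j)) (normr_ge0 y).
    by nra.
  rewrite RintegralD//; last 2 first.
  - exact: intg_cst.
  - by apply: intgZ; exact: (sqi_sqr (dti j)).
  rewrite Rintegral_cst// RintegralZl//; last exact: (sqi_sqr (dti j)).
  rewrite mulrDl mul1r lerD//; first by rewrite mulrC.
  rewrite -ler_pdivlMl// -invfM -expr2; exact: dd.
(* Cutting off outside [A] makes the sequence converge everywhere, so that its limit is
   measurable. *)
pose tA j x := t j x * \1_A x.
have mtA j : measurable_fun setT (tA j).
  by apply: measurable_funM; [exact: (sqi_measurable (ti j))|exact: measurable_indic].
have tAcvg x : cvgn (tA ^~ x).
  have [Ax|nAx] := pselect (A x).
    by apply: is_cvgM; [exact: Acvg|exact: is_cvg_cst].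
  rewrite (_ : tA ^~ x = cst 0); first exact: is_cvg_cst.
  by apply: funext => j; rewrite /tA indicE memNset// mulr0.
pose u x := limn (tA ^~ x).
have mu_ : measurable_fun setT u.
  by apply: (measurable_fun_cvg mtA) => x _; exact: tAcvg.
have aeA : {ae mu, forall x, A x}.
  by exists (~` A); split => //; exact: measurableC.
(* Stated with the extended real integral, since the integrability of the squared difference is
   deduced from this very bound. *)
have bound e N n : (forall k, (N <= k)%N -> ip (fun x => s n x - s k x) (fun x => s n x - s k x) <= e) ->
    (\int[mu]_x ((s n x - u x) ^+ 2)%:E <= e%:E)%E.
  move=> sne.
  have -> : (\int[mu]_x ((s n x - u x) ^+ 2)%:E =
      \int[mu]_x limn_einf (fun j => ((s n x - tA j x) ^+ 2)%:E))%E.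
    apply: eq_integral => x _; have cv : ((s n x - tA j x) ^+ 2)%:E @[j --> \oo] -->
        ((s n x - u x) ^+ 2)%:E.
      apply: cvg_EFin; first by apply: nearW.
      apply: (@cvgM _ _ _ _ (fun j => s n x - tA j x) (fun j => s n x - tA j x));
      by apply: cvgB; [exact: cvg_cst|exact: tAcvg].
    by rewrite is_cvg_limn_einfE; [rewrite (cvg_lim _ cv)|apply/cvg_ex; exists (((s n x - u x) ^+ 2)%:E)].
  apply: le_trans (fatou _ _ _ _) _ => //.
  - move=> j; apply/measurable_EFinP/measurable_funX/measurable_funB => //.
    exact: (sqi_measurable (si n)).
  - by move=> j x _; rewrite lee_fin sqr_ge0.
  rewrite limn_einf_lim; apply: lime_le; first exact: is_cvg_einfs.
  apply: nearW => k; apply: (@le_trans _ _ (\int[mu]_x ((s n x - tA (k + N)%N x) ^+ 2)%:E)%E).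
    by apply: ereal_inf_lbound; exists (k + N)%N => //=; rewrite leq_addr.
  have := sne (n_ (k + N)%N) (leq_trans (leq_addl _ _) (nj _)).
  rewrite -lee_fin; apply: le_trans.
  rewrite fineK; last exact: (integrable_fin_num measurableT (sqi_mul (sqiB (si n) (ti _)) (sqiB (si n) (ti _)))).
  apply: ae_ge0_le_integral => //.
  - by move=> x _; rewrite lee_fin sqr_ge0.
  - apply/measurable_EFinP/measurable_funX/measurable_funB => //.
    exact: (sqi_measurable (si n)).
  - by move=> x _; rewrite lee_fin -expr2 sqr_ge0.
  - apply/measurable_EFinP; apply: measurable_funM; exact: (sqi_measurable (sqiB (si n) (ti _))).
  - by apply: filterS aeA => x Ax _; rewrite lee_fin /tA indicE mem_set// mulr1 expr2.
have su n : sqi (fun x => s n x - u x).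
  have [N NP] := cauchy_s 1 ltr01.
  have suN : sqi (fun x => s N x - u x).
    have mN : measurable_fun setT (fun x => s N x - u x).
      by apply: measurable_funB => //; exact: (sqi_measurable (si N)).
    apply/sqiP; split=> //; apply/integrableP; split.
      exact/measurable_EFinP/measurable_funX.
    under eq_integral do rewrite /= ger0_norm ?sqr_ge0//.
    exact: le_lt_trans (bound 1 N N (fun k Nk => NP _ _ (leqnn N) Nk)) (ltry _).
  have -> : (fun x => s n x - u x) = (fun x => s n x - s N x + (s N x - u x)).
    by apply: funext => x; ring.
  by apply: sqiD => //; exact: sqiB.
exists u.
  have -> : u = (fun x => s 0 x - (s 0 x - u x)) by apply: funext => x; ring.
  exact: sqiB.
move=> e /cauchy_s[N NP]; exists N => n Nn.
have := bound e N n (fun k Nk => NP n k Nn Nk).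
rewrite -lee_fin; apply: le_trans; rewrite fineK.
  by [].
exact: (integrable_fin_num measurableT (sqi_mul (su n) (su n))).
Qed.
End finite_measure_L2_complete.

(** * Integration over the box *)

Section continuous_rV.
Context {R : realType}.
Implicit Types d : nat.
Local Notation mu := box_measure.
Local Notation ebase i := (delta_mx ord0 i).

Lemma measurable_fun_into_countable disp (T : measurableType disp)
    (Z : countType) (g : T -> Z) (F : Z -> R) :
  (forall z, measurable (g @^-1` [set z])) -> measurable_fun setT (F \o g).
Proof.
move=> mg _ Y mY; rewrite setTI.
rewrite (_ : _ @^-1` Y = \bigcup_(z in [set: Z]) (g @^-1` [set z] `&` [set _ | Y (F z)])).
  apply: countable_bigcupT_measurable; first exact: countableP.
  move=> z; have [YF|nYF] := pselect (Y (F z)).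
    by rewrite (_ : [set _ | _] = setT) ?setIT//; apply/seteqP; split.
  by rewrite (_ : [set _ | _] = set0) ?setI0//; apply/seteqP; split.
by apply/seteqP; split => [x Yx|x [z _ [/= -> //]]]; exists (g x).
Qed.

Lemma nbhs_rVP d (x : 'rV[R]_d) (A : set 'rV[R]_d) : nbhs x A ->
  exists2 e : R, 0 < e & forall y : 'rV[R]_d, (forall i, `|x ord0 i - y ord0 i| < e) -> A y.
Proof.
move=> /nbhs_ballP[e /= e0 xeA]; exists e => // y xy; apply: xeA.
by split=> // i j; rewrite (ord1 i); exact: xy.
Qed.

(* Continuous functions are pointwise limits of functions that are constant on
   the cells of the grid of mesh 1/n. *)
Lemma continuous_rV_measurable d (f : 'rV[R]_d -> R) : continuous f ->
  measurable_fun setT f.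
Proof.
move=> cf.
pose g n (x : 'rV[R]_d) : 'rV[int]_d := \row_i Num.floor (x ord0 i * n.+1%:R).
pose F n (z : 'rV[int]_d) : R := f (\row_i ((z ord0 i)%:~R / n.+1%:R)).
apply: (@measurable_fun_cvg _ _ _ _ (fun n => F n \o g n)) => [n|x _].
  apply: measurable_fun_into_countable => z.
  rewrite (_ : _ @^-1` _ = \bigcap_(i in [set: 'I_d])
      ((fun x : 'rV[R]_d => x ord0 i * n.+1%:R) @^-1` `[(z ord0 i)%:~R, (z ord0 i + 1)%:~R[)).
    apply: fin_bigcap_measurable => // i _; rewrite -[X in measurable X]setTI.
    apply: measurable_funM => //; exact: measurable_coord.
  apply/seteqP; split => [x /= <- i _|x /= xz].
    by rewrite /g /= mxE in_itv/= floor_itv.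
  apply/rowP => i; rewrite mxE; apply/eqP; rewrite Num.Theory.floor_eq//.
  by have := xz i Logic.I; rewrite /= in_itv.
apply/cvgrPdist_lt => e e0.
have /cvgrPdist_lt/(_ e e0)/nbhs_rVP[r r0 rP] := cf x.
have := near_infty_natSinv_lt (PosNum r0); apply: filterS => n /= nr.
apply: rP => i; rewrite !mxE.
have /andP[lo hi] := floor_itv (x ord0 i * n.+1%:R).
have n0 : (0 : R) < n.+1%:R by [].
move: lo hi; rewrite -ler_pdivrMr// intrD -ltr_pdivlMr// mulrDl mul1r => lo hi.
rewrite ger0_norm ?subr_ge0// ltrBlDl; apply: lt_trans hi _.
by rewrite ltrD2l.
Qed.

Definition box d (L : 'I_d -> R) : set 'rV[R]_d :=
  [set x | forall i, `[0, L i]%classic (x ord0 i)].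

Lemma measurable_rect d (A : 'I_d -> set (measurableTypeR R)) :
  (forall i, measurable (A i)) ->
  measurable [set x : 'rV[R]_d | forall i, A i (x ord0 i)].
Proof.
move=> mA; rewrite (_ : [set x | _] = \bigcap_(i in [set: 'I_d])
    ((fun x : 'rV[R]_d => x ord0 i) @^-1` A i)).
  apply: fin_bigcap_measurable => // i _.
  by have := measurable_coord i measurableT (mA i); rewrite setTI.
by apply/seteqP; split => x /= Ax i; [move=> _|]; exact: Ax.
Qed.

Lemma box_measureT d (L : 'I_d -> R) : (forall i, 0 < L i) ->
  box_measure L setT = (\prod_(i < d) L i)%:E.
Proof.
move=> L0; have := @box_measureE R d L (fun=> setT) (fun=> measurableT).
rewrite (_ : [set x | _] = setT); last by apply/seteqP; split.
move=> ->; rewrite -prodEFin; apply: eq_bigr => i _.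
by rewrite setTI lebesgue_measure_itv/= lte_fin L0 oppr0 adde0.
Qed.

(** In the product formula each factor is already intersected with [0, L i], so the box and the
    whole space have the same finite measure. *)
Lemma ae_box d (L : 'I_d -> R) : {ae mu L, forall x, box L x}.
Proof.
exists (~` box L); split => //.
  by apply: measurableC; apply: (@measurable_rect d (fun i => `[0, L i]%classic)) => i; exact: measurable_itv.
rewrite -setTD measureD//.
- have boxE : mu L (box L) = mu L setT.
    transitivity (mu L [set x | forall i, (fun=> setT) i (x ord0 i)]).
      rewrite (@box_measureE R d L (fun=> setT))//.
      rewrite [LHS](@box_measureE R d L (fun i => `[0, L i]%classic))//.
      by apply: eq_bigr => i _; rewrite setIid setTI.
    by congr (mu L _); apply/seteqP; split.
  by rewrite setTI [X in (_ - X)%E]boxE subee// fin_num_measure.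
- by apply: (@measurable_rect d (fun i => `[0, L i]%classic)) => i; exact: measurable_itv.
- by rewrite ltey_eq fin_num_measure.
Qed.

Lemma continuous_bounded_box d (L : 'I_d -> R) (f : 'rV[R]_d -> R) :
  continuous f -> exists K, forall x, box L x -> `|f x| <= K.
Proof.
move=> cf; have /compact_bounded[K [_ Kf]] : compact (f @` box L).
  apply: continuous_compact; first exact: continuous_subspaceT.
  by apply: (@rV_compact _ _ (fun i => `[0, L i]%classic)) => i; exact: segment_compact.
by exists (K + 1) => x Lx; apply: Kf; [rewrite ltrDl|exists x].
Qed.

Lemma sqi_continuous d (L : 'I_d -> R) (f : 'rV[R]_d -> R) : continuous f ->
  f \in Lfun (mu L) 2%:E.
Proof.
move=> cf; have [K Kf] := continuous_bounded_box L cf.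
apply: (@sqi_ae_bounded _ _ _ _ _ K); first exact: continuous_rV_measurable.
by apply: filterS (ae_box L).
Qed.

End continuous_rV.

(** * Integrals of derivatives of periodic functions *)

Section periodic_integral.
Context {R : realType}.
Implicit Types d : nat.
Local Notation mu := box_measure.
Local Notation ebase i := (delta_mx ord0 i).

(** The two difference quotients are the same function of [h]. Applied to coordinate slices, to the
    phase of a wave and to translations. *)
Lemma derive_comp_affine (U V W : normedModType R) (f : V -> W) (phi : U -> V)
    (a u : U) (v : V) : (forall h : R, phi (h *: u + a) = h *: v + phi a) ->
  (derivable f (phi a) v -> derivable (f \o phi) a u) /\
  'D_u (f \o phi) a = 'D_v f (phi a).
Proof.
move=> phiE; have E : (fun h : R => h^-1 *: ((f \o phi) (h *: u + a) - (f \o phi) a)) =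
    (fun h : R => h^-1 *: (f (h *: v + phi a) - f (phi a))).
  by apply: funext => h /=; rewrite phiE.
by split; rewrite /derivable /derive E.
Qed.

Lemma rV_cons_shift0 d (h t : R) (y : 'rV[R]_d) :
  rV_cons (h *: (1 : R) + t, y) = h *: ebase ord0 + rV_cons (t, y).
Proof.
apply/rowP => i; rewrite [in RHS]mxE.
have [j ->|->] := unliftP ord0 i; rewrite ?rV_consS ?rV_cons0 !mxE eqxx /=.
  by rewrite mulr0 add0r.
by [].
Qed.

Lemma rV_cons_shiftS d (h t : R) (y : 'rV[R]_d) (j : 'I_d) :
  rV_cons (t, h *: ebase j + y) = h *: ebase (lift ord0 j) + rV_cons (t, y).
Proof.
apply/rowP => i; rewrite [in RHS]mxE.
have [k ->|->] := unliftP ord0 i; rewrite ?rV_consS ?rV_cons0 !mxE eqxx /=.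
  by rewrite (inj_eq lift_inj).
by rewrite mulr0 add0r.
Qed.

Lemma continuous_rV_consl d (y : 'rV[R]_d) :
  continuous (fun t : R => rV_cons (t, y)).
Proof.
move=> t A /nbhs_rVP[e e0 eA]; exists e => // s ts; apply: eA => i.
have [k ->|->] := unliftP ord0 i; rewrite ?rV_consS ?rV_cons0//.
by rewrite subrr normr0.
Qed.

Lemma continuous_rV_consr d (t : R) :
  continuous (fun y : 'rV[R]_d => rV_cons (t, y)).
Proof.
move=> y A /nbhs_rVP[e e0 eA]; apply/nbhs_ballP; exists e => // z [_ yz].
apply: eA => i; have [k ->|->] := unliftP ord0 i; rewrite ?rV_consS ?rV_cons0//.
  exact: yz.
by rewrite subrr normr0.
Qed.

Lemma integral_lebesgue_itv0 (l : R) (f : R -> R) :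
  (lebesgue_itv0 l).-integrable setT (EFin \o f) ->
  (\int[lebesgue_itv0 l]_t (f t)%:E = \int[lebesgue_measure]_(t in `[0%R, l]) (f t)%:E)%E.
Proof.
pose I := [set` `[0, l]] : set (measurableTypeR R).
move=> fi; rewrite (@negligible_integral _ _ _ _ setT (~` I))//.
- rewrite setTD setCK; apply: eq_measure_integral => A mA Al.
  by rewrite -[LHS]/(lebesgue_measure (A `&` I)) setIidl.
- by apply: measurableC; exact: measurable_itv.
- by rewrite -[LHS]/(lebesgue_measure (~` I `&` I)) setICl measure0.
Qed.

Lemma integral_derive_periodic1 (l : R) (F : R -> R) : 0 < l ->
  (forall t, derivable F t 1) -> continuous ('D_1 F) -> F l = F 0 ->
  (\int[lebesgue_itv0 l]_t ('D_1 F t)%:E = 0)%E.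
Proof.
move=> l0 dF cF FlF0.
have cFF : continuous F.
  by move=> t; apply: differentiable_continuous; apply/derivable1_diffP.
rewrite integral_lebesgue_itv0.
  rewrite (@continuous_FTC2 _ _ F)//.
  - by rewrite FlF0 subee.
  - exact: continuous_subspaceT.
  - split => //.
    + by apply: cvg_at_right_filter; exact: cFF.
    + by apply: cvg_at_left_filter; exact: cFF.
  - by move=> t _; rewrite derive1E.
have [K [_ KF]] : bounded_set ('D_1 F @` `[0, l]%classic).
  apply: compact_bounded; apply: continuous_compact; first exact: continuous_subspaceT.
  exact: segment_compact.
apply: sqi_intg; apply: (@sqi_ae_bounded _ _ _ _ _ (K + 1)).
  exact: continuous_measurable_fun.
exists (~` `[0, l]%classic); split.
- by apply: measurableC; exact: measurable_itv.
- by rewrite -[LHS]/(lebesgue_measure (~` `[0%R, l]%classic `&` `[0%R, l]%classic)) setICl measure0.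
- by apply: subsetC => t /= tl; apply: KF; [rewrite ltrDl|exists t].
Qed.

(* The integral of a partial derivative vanishes by Fubini: fix all coordinates
   but the one that is differentiated. *)
Lemma integral_derive_periodic d (L : 'I_d -> R) (i : 'I_d) (eta : 'rV[R]_d -> R) :
  (forall j, 0 < L j) -> (forall x, derivable eta x (ebase i)) ->
  continuous ('D_(ebase i) eta) ->
  (forall x, eta (x + L i *: ebase i) = eta x) ->
  (\int[mu L]_x ('D_(ebase i) eta x)%:E = 0)%E.
Proof.
elim: d L i eta => [|d IHd] L i eta L0 deta ceta peta; first by case: i {deta ceta peta}.
set h := 'D_(ebase i) eta.
have mh : measurable_fun setT h by exact: continuous_rV_measurable.
have hi := sqi_intg (sqi_continuous L ceta).
(* Integrability on the product allows Fubini in either order. *)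
have hpi : ((lebesgue_itv0 (L ord0)) \x (mu (L \o lift ord0)))%E.-integrable setT
    ((EFin \o h) \o rV_cons).
  apply/integrableP; split.
    apply/measurable_EFinP; apply: (measurableT_comp mh).
    exact: measurable_rV_cons.
  have /integrableP[_] := hi.
  rewrite (ge0_integral_pushforward measurable_rV_cons)//.
  by apply: measurableT_comp => //; exact/measurable_EFinP.
transitivity (\int[(lebesgue_itv0 (L ord0)) \x (mu (L \o lift ord0))]_p
   ((EFin \o h) \o rV_cons) p)%E.
  apply: (@integral_pushforward _ _ _ _ _ _ measurable_rV_cons) => //.
  exact/measurable_EFinP.
(* The inner integral is taken over the variables that include the differentiated one: the last d
   coordinates, by induction, or the first one, by the fundamental theorem of calculus. *)
have [j ij|i0] := unliftP ord0 i.
  rewrite -integral12_prod_meas1//= integral0_eq// => t _.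
  have D y := derive_comp_affine eta (fun h => rV_cons_shiftS h t y j).
  subst i; have DE : 'D_(ebase j) (fun y => eta (rV_cons (t, y))) =
      fun y => h (rV_cons (t, y)) by apply: funext => y; exact: (D y).2.
  transitivity (\int[mu (L \o lift ord0)]_y
      ('D_(ebase j) (fun y => eta (rV_cons (t, y))) y)%:E)%E.
    by apply: eq_integral => y _; congr EFin; exact: (esym (D y).2).
  apply: IHd => [k|y||y].
  - exact: L0.
  - by apply: (D y).1; exact: deta.
  - rewrite DE => y; apply: continuous_comp; first exact: continuous_rV_consr.
    exact: ceta.
  - by rewrite addrC rV_cons_shiftS addrC; exact: peta.
rewrite -integral21_prod_meas1//= integral0_eq// => y _.
have D t := @derive_comp_affine R _ _ eta (fun t => rV_cons (t, y)) t 1 _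
  (fun h => rV_cons_shift0 h t y).
subst i; have DE : 'D_1 (fun t : R => eta (rV_cons (t, y))) =
    fun t => h (rV_cons (t, y)) by apply: funext => t; exact: (D t).2.
transitivity (\int[lebesgue_itv0 (L ord0)]_t
    ('D_1 (fun t : R => eta (rV_cons (t, y))) t)%:E)%E.
  by apply: eq_integral => t _; congr EFin; exact: (esym (D t).2).
apply: integral_derive_periodic1 => [|t||].
- exact: L0.
- by apply: (D t).1; exact: deta.
- rewrite DE => t; apply: continuous_comp; first exact: continuous_rV_consl.
  exact: ceta.
- rewrite -[RHS]peta addrC -rV_cons_shift0; congr (eta (rV_cons (_, y))).
  by rewrite addr0 [LHS](esym (mulr1 _)).
Qed.

End periodic_integral.

(** * The Hartley system *)

Section continuous_real.
Context {U : topologicalType} {R : realType}.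
Implicit Types f g : U -> R.

Lemma continuous_add f g : continuous f -> continuous g ->
  continuous (fun x => f x + g x).
Proof. by move=> cf cg x; apply: cvgD; [exact: cf|exact: cg]. Qed.

Lemma continuous_mul f g : continuous f -> continuous g ->
  continuous (fun x => f x * g x).
Proof. by move=> cf cg x; apply: cvgM; [exact: cf|exact: cg]. Qed.

Lemma continuous_scale (c : R) f : continuous f -> continuous (fun x => c * f x).
Proof. by move=> cf; apply: continuous_mul => // x; exact: cvg_cst. Qed.

End continuous_real.

Section hartley.
Context {R : realType} {d : nat}.
Variable L : 'I_d -> R.
Hypothesis L0 : forall i, 0 < L i.
Local Notation mu := (box_measure L).
Local Notation ebase i := (delta_mx ord0 i : 'rV[R]_d).
Local Notation ip := (ip mu).
Local Notation J := {ffun 'I_d -> int}.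
Local Notation vol := (\prod_(i < d) L i).

Definition freq (k : J) (i : 'I_d) : R := pi *+ 2 / L i * (k i)%:~R.

Definition phase (k : J) (x : 'rV[R]_d) : R := \sum_(i < d) freq k i * x ord0 i.

Lemma freqN k i : freq (- k) i = - freq k i.
Proof. by rewrite /freq ffunE rmorphN mulrN. Qed.

Lemma phaseD j k x : phase (j + k) x = phase j x + phase k x.
Proof.
rewrite /phase -big_split; apply: eq_bigr => i _ /=.
by rewrite /freq ffunE rmorphD mulrDr mulrDl.
Qed.

Lemma phaseN k x : phase (- k) x = - phase k x.
Proof. by rewrite /phase -sumrN; apply: eq_bigr => i _; rewrite freqN mulNr. Qed.

Lemma phase0 x : phase 0 x = 0.
Proof. by apply: big1 => i _; rewrite /freq ffunE mulr0 mul0r. Qed.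

Lemma phase_shift k i h x :
  phase k (h *: ebase i + x) = h *: freq k i + phase k x.
Proof.
rewrite /phase (eq_bigr (fun j => freq k j * (h * ebase i ord0 j) + freq k j * x ord0 j)).
  rewrite big_split /=; congr (_ + _).
  rewrite (bigD1 i)//= big1 ?addr0 => [|j ji].
    by rewrite mxE !eqxx mulr1 mulrC.
  by rewrite mxE (negbTE ji) andbF !mulr0.
by move=> j _; rewrite !mxE mulrDr.
Qed.

Lemma differentiable_phase k x : differentiable (phase k) x.
Proof.
rewrite (_ : phase k = \sum_(i < d) (freq k i *: (fun x : 'rV[R]_d => x ord0 i))).
  apply: differentiable_sum => i; apply: differentiableZ.
  exact: differentiable_coord.
by apply: funext => y; rewrite fct_sumE.
Qed.

Lemma continuous_phase k : continuous (phase k).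
Proof. by move=> x; exact: differentiable_continuous (differentiable_phase k x). Qed.

Lemma derive_wave (f f' : R -> R) k i x : (forall y : R, is_derive y 1 f (f' y)) ->
  derivable (f \o phase k) x (ebase i) /\
  'D_(ebase i) (f \o phase k) x = freq k i * f' (phase k x).
Proof.
move=> ff'; have df : differentiable f (phase k x).
  by apply/derivable1_diffP; case: (ff' (phase k x)).
have [D1 D2] := @derive_comp_affine R _ _ _ f (phase k) x (ebase i) (freq k i)
  (fun h => phase_shift k i h x).
split; first by apply: D1; exact: diff_derivable.
by rewrite D2 deriveE// diff1E// derive1E; case: (ff' (phase k x)) => _ ->.
Qed.

Lemma sinDintpi (x : R) (n : int) : sin (x + pi *+ 2 * n%:~R) = sin x.
Proof.
have nat_case (y : R) (m : nat) : sin (y + pi *+ 2 * m%:~R) = sin y.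
  by rewrite -pmulrn mulr_natr; exact: (periodicn (@sinD2pi R)).
case: n => n; first exact: nat_case.
by rewrite NegzE rmorphN mulrN -(nat_case _ n.+1) subrK.
Qed.

Lemma cosDintpi (x : R) (n : int) : cos (x + pi *+ 2 * n%:~R) = cos x.
Proof. by rewrite -!sinDpihalf addrAC sinDintpi. Qed.

Lemma phase_period k i x :
  phase k (x + L i *: ebase i) = phase k x + pi *+ 2 * (k i)%:~R.
Proof.
rewrite addrC phase_shift addrC; congr (_ + _); rewrite /freq /GRing.scale /=.
by field; rewrite gt_eqF.
Qed.

(** With an arbitrary shift the family contains sines and cosines, and a product of two members is a
    combination of two members. *)
Definition wave (k : J) (s : R) (x : 'rV[R]_d) : R := cos (phase k x + s).

Lemma continuous_wave k s : continuous (wave k s).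
Proof.
move=> x; apply: (@continuous_comp _ _ _ (phase k) (fun y => cos (y + s))).
  exact: continuous_phase.
apply: (@continuous_comp _ _ _ (fun y => y + s) cos); last exact: continuous_cos.
by apply: continuous_add => // y; first [exact: cvg_cst|exact: cvg_id].
Qed.

Lemma measurable_wave k s : measurable_fun setT (wave k s).
Proof. by apply: continuous_rV_measurable; exact: continuous_wave. Qed.

Lemma wave_le1 k s x : `|wave k s x| <= 1.
Proof. by rewrite ler_norml cos_geN1 cos_le1. Qed.

(** If [k i != 0], the wave is, up to the factor [freq k i], the i-th partial derivative of a
    periodic sine. *)
Lemma Rintegral_wave k s : k != 0 -> \int[mu]_x wave k s x = 0.
Proof.
move=> k0; have [i ki] : exists i, k i != 0.
  apply/existsP; move: k0; apply: contraR; rewrite negb_exists => /forallP k0.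
  by apply/eqP/ffunP => i; rewrite ffunE; apply/eqP; have := k0 i; rewrite negbK.
have D x := @derive_wave (fun y => sin (y + s)) (fun y => cos (y + s)) k i x.
have ff' (y : R) : is_derive y 1 (fun y => sin (y + s)) (cos (y + s)).
  have -> : cos (y + s) = cos (y + s) * (1 + 0) by rewrite addr0 mulr1.
  apply: (@is_derive1_comp _ _ (fun y => y + s)).
have fk0 : freq k i != 0.
  by rewrite mulf_neq0 ?intr_eq0// mulf_neq0 ?invr_eq0 ?gt_eqF// mulrn_wgt0 ?pi_gt0.
have DE : 'D_(ebase i) ((fun y => sin (y + s)) \o phase k) = fun x => freq k i * wave k s x.
  by apply: funext => x; rewrite (D x ff').2.
have : \int[mu]_x (freq k i * wave k s x) = 0.
  rewrite -[RHS]/(fine 0) -(@integral_derive_periodic R d L i ((fun y => sin (y + s)) \o phase k))//.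
  - congr fine; apply: eq_integral => x _; congr EFin; exact: (esym (D x ff').2).
  - by move=> x; exact: (D x ff').1.
  - by rewrite DE; apply: continuous_scale; exact: continuous_wave.
  - by move=> x /=; rewrite phase_period addrAC sinDintpi.
rewrite RintegralZl//; last first.
  exact: (intg_bounded mu (measurable_wave k s) (wave_le1 k s)).
by move=> /eqP; rewrite mulf_eq0 (negbTE fk0) => /eqP.
Qed.

(* The real-valued system [cos + sin] (Hartley's basis) plays the role of the
   complex exponentials: [D_i (hart k) = freq k i * hart (- k)]. *)
Definition hart (k : J) (x : 'rV[R]_d) : R := cos (phase k x) + sin (phase k x).

Lemma hartE k : hart k = (fun y => cos y + sin y) \o phase k.
Proof. by []. Qed.

Lemma derive_hart k i x : derivable (hart k) x (ebase i) /\
  'D_(ebase i) (hart k) x = freq k i * hart (- k) x.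
Proof.
have ff' (y : R) : is_derive y 1 (fun y => cos y + sin y) (- sin y + cos y).
  exact: (is_deriveD (is_derive_cos y) (is_derive_sin y)).
have [D1 D2] := derive_wave k i x ff'.
by split=> //; rewrite hartE D2 /hart phaseN cosN sinN addrC.
Qed.

Lemma differentiable_hart k x : differentiable (hart k) x.
Proof.
apply: (@differentiable_comp _ _ _ _ (phase k) (fun y => cos y + sin y)).
  exact: differentiable_phase.
by apply/derivable1_diffP; apply: derivableD.
Qed.

Lemma continuous_hart k : continuous (hart k).
Proof. by move=> x; exact: differentiable_continuous (differentiable_hart k x). Qed.

Lemma periodic_hart k : Defs.periodic L (hart k).
Proof. by move=> i x; rewrite /hart phase_period cosDintpi sinDintpi. Qed.

Lemma hart_le2 k x : `|hart k x| <= 2.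
Proof.
apply: le_trans (ler_normD _ _) _.
by have := cos_max (phase k x); have := sin_max (phase k x); lra.
Qed.

Lemma sqi_hart k : hart k \in Lfun mu 2%:E.
Proof. by apply: sqi_continuous; exact: continuous_hart. Qed.

Lemma hart0 x : hart 0 x = 1.
Proof. by rewrite /hart phase0 cos0 sin0 addr0. Qed.

(** (cos a + sin a)(cos b + sin b) = cos (a - b) + sin (a + b). The sine has zero mean at every
    frequency, zero included; the cosine has a mean only at frequency 0. *)
Lemma ip_hart j k : ip (hart j) (hart k) = if j == k then vol else 0.
Proof.
have intw m s : mu.-integrable setT (EFin \o wave m s).
  exact: (intg_bounded mu (measurable_wave m s) (wave_le1 m s)).
have -> : ip (hart j) (hart k) = \int[mu]_x (wave (j - k) 0 x + wave (j + k) (- (pi / 2)) x).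
  apply: eq_Rintegral => x _; rewrite /hart /wave addr0 cosBpihalf !phaseD phaseN.
  by rewrite cosB sinD; ring.
have I2 : \int[mu]_x wave (j + k) (- (pi / 2)) x = 0.
  have [->|jk] := eqVneq (j + k) 0; last exact: Rintegral_wave.
  under eq_Rintegral do rewrite /wave phase0 cosBpihalf sin0.
  by rewrite Rintegral_cst// mul0r.
rewrite RintegralD// I2 addr0; have [->|jk] := eqVneq j k.
  under eq_Rintegral do rewrite /wave subrr phase0 addr0 cos0.
  by rewrite Rintegral_cst// mul1r; exact: (congr1 fine (box_measureT L0)).
by rewrite Rintegral_wave// subr_eq0.
Qed.

Lemma ip_derive (a b : 'rV[R]_d -> R) i :
  (forall x, differentiable a x) -> (forall x, differentiable b x) ->
  continuous ('D_(ebase i) a) -> continuous ('D_(ebase i) b) ->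
  Defs.periodic L a -> Defs.periodic L b ->
  ip a ('D_(ebase i) b) = - ip ('D_(ebase i) a) b.
Proof.
move=> da db ca cb pa pb.
have cca : continuous a by move=> x; exact: differentiable_continuous.
have ccb : continuous b by move=> x; exact: differentiable_continuous.
have DE : 'D_(ebase i) (a * b) = fun x => a x * 'D_(ebase i) b x + 'D_(ebase i) a x * b x.
  apply: funext => x; rewrite deriveM; [|exact: diff_derivable..].
  by rewrite /GRing.scale /= [b x * _]mulrC.
apply/eqP; rewrite -addr_eq0; apply/eqP.
rewrite /ip -RintegralD//; [|by apply: sqi_mul; exact: sqi_continuous..].
rewrite -[RHS]/(fine 0) -(@integral_derive_periodic R d L i (a * b))//.
- by congr fine; apply: eq_integral => x _; congr EFin; exact: (esym (congr1 (fun f => f x) DE)).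
- by move=> x; apply: diff_derivable; exact: differentiableM.
- by rewrite DE; apply: continuous_add; apply: continuous_mul.
- by move=> x; rewrite -![(a * b) _]/(a _ * b _) pa pb.
Qed.

End hartley.

(** * Completeness of the Hartley system *)

Section threshold.
Context {R : realType}.
Implicit Types y z : R.

Lemma bernoulli_ge z N : 0 <= z <= 1 -> 1 - N%:R * z <= (1 - z) ^+ N.
Proof.
move=> /andP[z0 z1]; elim: N => [|N IHN]; first by rewrite mul0r subr0 expr0.
rewrite exprS; apply: (@le_trans _ _ ((1 - z) * (1 - N%:R * z))).
  rewrite -natr1; have : 0 <= N%:R * z * z by rewrite !mulr_ge0.
  by move: (N%:R : R) => a; nra.
by rewrite ler_wpM2l// subr_ge0.
Qed.

(** A division-free form of (1 - z)^N <= (1 + z)^-N <= 1 / (1 + N z). *)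
Lemma bernoulli_le z N : 0 <= z <= 1 -> (1 - z) ^+ N * (1 + N%:R * z) <= 1.
Proof.
move=> /andP[z0 z1]; elim: N => [|N IHN]; first by rewrite mul0r addr0 expr0 mulr1.
apply: le_trans IHN; rewrite exprS -mulrA mulrCA ler_wpM2l//.
  by rewrite exprn_ge0// subr_ge0.
rewrite -natr1; have : 0 <= N%:R * z * z by rewrite !mulr_ge0.
by have := sqr_ge0 z; rewrite expr2; move: (N%:R : R) => a; nra.
Qed.

(* By Bernoulli's inequality these polynomials in [y] converge on [0, 1] to the
   indicator of [y < 1/2], except at [y = 1/2]. *)
Definition step_poly (n : nat) y : R := (1 - y ^+ n) ^+ (2 ^ n).

Lemma step_poly_bound n y : 0 <= y <= 1 -> 0 <= step_poly n y <= 1.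
Proof.
move=> /andP[y0 y1]; have yn : 0 <= 1 - y ^+ n by rewrite subr_ge0 exprn_ile1.
by rewrite exprn_ge0//= exprn_ile1// gerBl exprn_ge0.
Qed.

Lemma step_poly_lt y : 0 <= y -> y < 2^-1 -> step_poly n y @[n --> \oo] --> (1 : R).
Proof.
move=> y0 y2; have y1 : y <= 1 by lra.
have ny : `|2 * y| < 1 by rewrite ger0_norm; lra.
apply: (@squeeze_cvgr _ _ _ _ (fun n => 1 - (2 * y) ^+ n) (fun=> 1)).
- apply: nearW => n; rewrite (andP (step_poly_bound n _)).2 ?y0// andbT exprMn.
  rewrite -natrX; apply: bernoulli_ge.
  by rewrite exprn_ge0//= exprn_ile1.
- rewrite -[X in _ --> X]subr0; apply: cvgB; [exact: cvg_cst|exact: cvg_expr].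
- exact: cvg_cst.
Qed.

Lemma step_poly_gt y : 2^-1 < y -> y <= 1 -> step_poly n y @[n --> \oo] --> (0 : R).
Proof.
move=> y2 y1; have y0 : 0 <= y by lra.
have yp : 0 < 2 * y by lra.
have ny : `|(2 * y)^-1| < 1 by rewrite ger0_norm ?invr_ge0 ?invf_lt1//; lra.
apply: (@squeeze_cvgr _ _ _ _ (fun=> 0) (fun n => (2 * y)^-1 ^+ n)).
- apply: nearW => n; rewrite (andP (step_poly_bound n _)).1 ?y0//=.
  rewrite exprVn -[leRHS]mul1r ler_pdivlMr ?exprn_gt0//.
  apply: le_trans (@bernoulli_le (y ^+ n) (2 ^ n) _); last first.
    by rewrite exprn_ge0//= exprn_ile1.
  rewrite exprMn -natrX ler_wpM2l ?lerDr//.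
  by case/andP: (@step_poly_bound n y ltac:(by rewrite y0)).
- exact: cvg_cst.
- exact: cvg_expr.
Qed.

End threshold.

Section completeness.
Context {R : realType} {d : nat}.
Variable L : 'I_d -> R.
Hypothesis L0 : forall i, 0 < L i.
Local Notation mu := (box_measure L).
Local Notation intg f := (mu.-integrable setT (EFin \o f)).
Local Notation J := {ffun 'I_d -> int}.
Local Notation wave := (wave L).

(** Integrability is the right class here: waves are bounded, and the class is stable under
    multiplication by bounded measurable functions. *)
Definition annihilated (v : 'rV[R]_d -> R) := intg v /\
  forall k s, \int[mu]_x (v x * wave k s x) = 0.

(* Bounded pointwise limits of multipliers are multipliers, hence the sets whose
   indicator is a multiplier form a sigma-algebra; it contains the half-spaces
   [x_i < r] (up to null sets), hence all measurable sets. *)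
Definition multiplier (g : 'rV[R]_d -> R) := [/\ measurable_fun setT g,
  exists c, forall x, `|g x| <= c &
  forall v, annihilated v -> annihilated (fun x => v x * g x)].

Lemma intg_wave v k s : intg v -> intg (fun x => v x * wave k s x).
Proof. by move=> vi; exact: (intgM_bounded vi (@measurable_wave _ _ L k s) (@wave_le1 _ _ L k s)). Qed.

Lemma annihilated_intg v : annihilated v -> intg v. Proof. by case. Qed.

Lemma annihilatedD u v : annihilated u -> annihilated v ->
  annihilated (fun x => u x + v x).
Proof.
move=> [ui u0] [vi v0]; split=> [|k s]; first exact: intgD.
under eq_Rintegral do rewrite mulrDl.
by rewrite RintegralD ?u0 ?v0 ?addr0//; exact: intg_wave.
Qed.

Lemma annihilatedZ c v : annihilated v -> annihilated (fun x => c * v x).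
Proof.
move=> [vi v0]; split=> [|k s]; first exact: intgZ.
under eq_Rintegral do rewrite -mulrA.
by rewrite RintegralZl ?v0 ?mulr0//; exact: intg_wave.
Qed.

Lemma multiplier_cst c : multiplier (fun=> c).
Proof.
split=> [//||v /(annihilatedZ c)]; first by exists `|c|.
by congr annihilated; apply: funext => x; rewrite mulrC.
Qed.

Lemma multiplierD f g : multiplier f -> multiplier g ->
  multiplier (fun x => f x + g x).
Proof.
move=> [mf [a fa] fM] [mg [b gb] gM]; split.
- exact: measurable_funD.
- by exists (a + b) => x; rewrite (le_trans (ler_normD _ _))// lerD.
- move=> v /[dup] /fM vf /gM vg; have := annihilatedD vf vg.
  by congr annihilated; apply: funext => x; rewrite mulrDr.
Qed.

Lemma multiplierM f g : multiplier f -> multiplier g ->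
  multiplier (fun x => f x * g x).
Proof.
move=> [mf [a fa] fM] [mg [b gb] gM]; split.
- exact: measurable_funM.
- by exists (a * b) => x; rewrite normrM ler_pM.
- move=> v /fM/gM; by congr annihilated; apply: funext => x; rewrite mulrA.
Qed.

Lemma multiplierZ c g : multiplier g -> multiplier (fun x => c * g x).
Proof. by apply: multiplierM; exact: multiplier_cst. Qed.

Lemma multiplierB f g : multiplier f -> multiplier g ->
  multiplier (fun x => f x - g x).
Proof.
move=> fM /(multiplierZ (-1)) gM; have := multiplierD fM gM.
by congr multiplier; apply: funext => x; rewrite mulN1r.
Qed.

Lemma multiplierX g n : multiplier g -> multiplier (fun x => g x ^+ n).
Proof.
move=> gM; elim: n => [|n IHn]; first exact: multiplier_cst.
by have := multiplierM gM IHn; congr multiplier; apply: funext => x; rewrite exprS.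
Qed.

(** The product-to-sum formula reduces a test against [wave k s] to tests against waves of
    frequencies [m + k] and [m - k]. *)
Lemma multiplier_wave m t : multiplier (wave m t).
Proof.
split=> [||v vM]; [exact: measurable_wave|by exists 1; exact: wave_le1|].
have vi := annihilated_intg vM.
split=> [|k s]; first exact: intg_wave.
have -> : \int[mu]_x (v x * wave m t x * wave k s x) =
    \int[mu]_x (2^-1 * (v x * wave (m + k) (t + s) x + v x * wave (m - k) (t - s) x)).
  apply: eq_Rintegral => x _; rewrite /wave !phaseD phaseN.
  have -> : phase L m x + phase L k x + (t + s) = (phase L m x + t) + (phase L k x + s) by ring.
  have -> : phase L m x - phase L k x + (t - s) = (phase L m x + t) - (phase L k x + s) by ring.
  move: (phase L m x + t) (phase L k x + s) => a b; rewrite cosD cosB.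
  by field.
rewrite RintegralZl//; last by apply: intgD; exact: intg_wave.
by rewrite RintegralD ?vM.2 ?addr0 ?mulr0//; exact: intg_wave.
Qed.

(** Dominated convergence, with dominating function c |v|. *)
Lemma multiplier_lim (g_ : nat -> 'rV[R]_d -> R) (g : 'rV[R]_d -> R) (c : R) :
  (forall n, multiplier (g_ n)) -> (forall n x, `|g_ n x| <= c) ->
  measurable_fun setT g -> (forall x, `|g x| <= c) ->
  {ae mu, forall x, g_ n x @[n --> \oo] --> g x} -> multiplier g.
Proof.
move=> gM g_c mg gc g_g; split=> //; first by exists c.
move=> v vA; have vi := annihilated_intg vA; have mv := intg_measurable vi.
split=> [|k s]; first exact: (intgM_bounded vi mg gc).
have mw := @measurable_wave _ _ L k s.
have mgn n : measurable_fun setT (g_ n) by case: (gM n).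
pose f_ n x := (v x * g_ n x * wave k s x)%:E.
pose f x := (v x * g x * wave k s x)%:E.
have mf_ n : measurable_fun setT (f_ n).
  by apply/measurable_EFinP; do 2 apply: measurable_funM => //.
have mf : measurable_fun setT f.
  by apply/measurable_EFinP; do 2 apply: measurable_funM => //.
have f_f : {ae mu, forall x, setT x -> f_ ^~ x @ \oo --> f x}.
  apply: filterS g_g => x g_gx _; apply: cvg_EFin; first exact: nearW.
  apply: (@cvgM _ _ _ _ (fun n => v x * g_ n x) (cst (wave k s x))); last exact: cvg_cst.
  by apply: (@cvgM _ _ _ _ (cst (v x)) (g_ ^~ x)) => //; exact: cvg_cst.
have ig : mu.-integrable setT (fun x => (c * `|v x|)%:E).
  by apply: intgZ; exact: (integrable_norm vi).
have f_c : {ae mu, forall x n, setT x -> (`|f_ n x| <= (c * `|v x|)%:E)%E}.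
  apply: aeW => x n _; rewrite /f_ /= lee_fin !normrM [c * _]mulrC -mulrA ler_wpM2l//.
  rewrite -[leRHS]mulr1 ler_pM//; exact: wave_le1.
have [_ _] := dominated_convergence measurableT mf_ mf f_f ig f_c.
rewrite (_ : [sequence _]_n = fun=> 0%E); last first.
  apply: funext => n /=; have [_ _ /(_ v vA)[gi /(_ k s) I0]] := gM n.
  have gwi := intg_wave k s gi.
  by rewrite -[LHS]fineK ?(integrable_fin_num measurableT gwi)//; congr EFin.
by rewrite /Rintegral => /cvg_lim <-//; rewrite lim_cst.
Qed.

Lemma multiplier_ae (g h : 'rV[R]_d -> R) (c : R) : multiplier g -> measurable_fun setT h ->
  (forall x, `|g x| <= c) -> (forall x, `|h x| <= c) ->
  {ae mu, forall x, g x = h x} -> multiplier h.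
Proof.
move=> gM mh gc hc gh; apply: (@multiplier_lim (fun=> g) h c) => //.
by apply: filterS gh => x ->; exact: cvg_cst.
Qed.

Lemma ae_coord_neq i a : {ae mu, forall x : 'rV[R]_d, x ord0 i != a}.
Proof.
pose A j : set (measurableTypeR R) := if j == i then [set a] else setT.
have mA j : measurable (A j) by rewrite /A; case: ifP.
exists [set x : 'rV[R]_d | forall j, A j (x ord0 j)]; split.
- exact: measurable_rect.
- rewrite box_measureE//; apply/eqP; rewrite (bigD1 i)//=.
  rewrite [X in (X * _)%E](_ : _ = 0%E) ?mul0e//; apply/eqP.
  rewrite -measure_le0 /A eqxx -(lebesgue_measure_set1 a) le_measure ?inE//.
  exact: measurableI.
- move=> x /= /negP; rewrite negbK => /eqP xa j; rewrite /A.
  by case: eqP => // ->.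
Qed.

Definition unit_freq i : J := [ffun j => (j == i)%:Z].

Lemma phase_unit i x : phase L (unit_freq i) x = pi *+ 2 / L i * x ord0 i.
Proof.
rewrite /phase (bigD1 i)//= big1 ?addr0 => [|j ji].
  by rewrite /freq ffunE eqxx mulr1.
by rewrite /freq ffunE (negbTE ji) mulr0 mul0r.
Qed.

(* With [w = 2 pi / L i] and [0 < x < L i]:
   [cos (w x - w r / 2) - cos (w r / 2) = 2 sin (w x / 2) sin (w (r - x) / 2)]
   has the sign of [r - x]. *)
Lemma cos_threshold i (r x : R) : 0 < r < L i -> 0 < x < L i -> r != x ->
  let w := pi *+ 2 / L i in
  (cos (w * r / 2) < cos (w * x + - (w * r / 2))) = (x < r) /\
  cos (w * x + - (w * r / 2)) != cos (w * r / 2).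
Proof.
move=> /andP[r0 rL] /andP[x0 xL] rx w.
have Li := L0 i; have pi0 := pi_gt0 R.
pose a := w * x / 2; pose b := w * (r - x) / 2.
have aE : a = pi * (x / L i) by rewrite /a /w; field; rewrite gt_eqF.
have bE : b = pi * ((r - x) / L i) by rewrite /b /w; field; rewrite gt_eqF.
have sa : 0 < sin a.
  apply: sin_gt0_pi; rewrite aE mulr_gt0 ?divr_gt0//= -[ltRHS]mulr1 ltr_pM2l//.
  by rewrite ltr_pdivrMr// mul1r.
have E : cos (w * x + - (w * r / 2)) - cos (w * r / 2) = 2 * (sin a * sin b).
  have -> : w * x + - (w * r / 2) = a - b by rewrite /a /b; field.
  have -> : w * r / 2 = a + b by rewrite /a /b; field.
  by rewrite cosB cosD; ring.
have sb : (0 < sin b) = (x < r) /\ sin b != 0.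
  have [xr|xr] := ltP x r.
    have : 0 < sin b.
      apply: sin_gt0_pi; rewrite bE mulr_gt0 ?divr_gt0 ?subr_gt0//=.
      by rewrite -[ltRHS]mulr1 ltr_pM2l// ltr_pdivrMr// mul1r; lra.
    by move=> sb; rewrite sb gt_eqF.
  have xr' : r < x by rewrite lt_neqAle rx.
  have : 0 < sin (- b).
    apply: sin_gt0_pi; rewrite bE -mulrN -mulNr opprB mulr_gt0 ?divr_gt0 ?subr_gt0//=.
    by rewrite -[ltRHS]mulr1 ltr_pM2l// ltr_pdivrMr// mul1r; lra.
  rewrite sinN oppr_gt0 => sb; split; last by rewrite lt_eqF.
  by apply/negbTE; rewrite -leNgt ltW.
split.
  by rewrite -subr_gt0 E pmulr_rgt0// pmulr_rgt0// sb.1.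
by rewrite -subr_eq0 E !mulf_neq0 ?sb.2// gt_eqF.
Qed.

Lemma multiplier_ray_inside i r : 0 < r < L i ->
  multiplier (\1_[set x : 'rV[R]_d | x ord0 i < r]).
Proof.
move=> rL; set w := pi *+ 2 / L i.
pose c := cos (w * r / 2); pose g := wave (unit_freq i) (- (w * r / 2)).
(* As c - g lies in [-2, 2], y lies in [0, 1], and y < 1/2 exactly where g > c. The shift of the
   wave is chosen so that, inside the box, this is the region x_i < r. *)
pose y x : R := 2^-1 + 4^-1 * (c - g x).
have mray : measurable [set x : 'rV[R]_d | x ord0 i < r].
  have := measurable_coord i measurableT (measurable_itv `]-oo, r[); rewrite setTI.
  by congr measurable; apply/seteqP; split => x /=; rewrite in_itv.
have y01 x : 0 <= y x <= 1.
  have := @wave_le1 _ _ L (unit_freq i) (- (w * r / 2)) x; rewrite ler_norml -/g.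
  have := cos_max (w * r / 2); rewrite ler_norml -/c /y.
  by move=> /andP[? ?] /andP[? ?]; lra.
have gM : multiplier g by exact: multiplier_wave.
have yM : multiplier y.
  apply: multiplierD; first exact: multiplier_cst.
  by apply: multiplierZ; apply: multiplierB => //; exact: multiplier_cst.
apply: (@multiplier_lim (fun n x => step_poly n (y x)) _ 1).
- move=> n; apply: multiplierX; apply: multiplierB; first exact: multiplier_cst.
  exact: multiplierX.
- move=> n x; have /andP[s0 s1] := step_poly_bound n (y01 x).
  by rewrite ger0_norm.
- exact: measurable_indic.
- by move=> x; rewrite indicE; case: (_ \in _); rewrite ?normr1 ?normr0.
(* The hyperplanes x_i = 0, x_i = L i and x_i = r, where g = c and y = 1/2, are discarded as null
   sets. *)
apply: filterS2 (filterI (ae_box L) (ae_coord_neq i 0))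
  (filterI (ae_coord_neq i (L i)) (ae_coord_neq i r)) => x [/(_ i)] + + [].
rewrite /= in_itv/= => /andP[x0 xL] xn0 xnL xr.
have x0L : 0 < x ord0 i < L i by rewrite !lt_neqAle eq_sym xn0 x0 xnL.
have [h1 h2] := cos_threshold rL x0L (ltac:(by rewrite eq_sym)).
have gE : g x = cos (w * x ord0 i + - (w * r / 2)) by rewrite /g /wave phase_unit.
move: h1 h2; rewrite -gE -/c => h1 h2; rewrite indicE.
have [xr'|xr'] := ltP (x ord0 i) r.
  rewrite mem_set//; apply: step_poly_lt; first by case/andP: (y01 x).
  by move: h1; rewrite xr' /y; lra.
rewrite memNset/=; last by rewrite ltNge xr'.
apply: step_poly_gt; last by case/andP: (y01 x).
have : g x < c by rewrite lt_neqAle h2 leNgt h1 -leNgt.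
by rewrite /y; lra.
Qed.

Lemma multiplier_ray i r : multiplier (\1_[set x : 'rV[R]_d | x ord0 i < r]).
Proof.
have [rL|] := boolP (0 < r < L i); first exact: multiplier_ray_inside.
have mray : measurable [set x : 'rV[R]_d | x ord0 i < r].
  have := measurable_coord i measurableT (measurable_itv `]-oo, r[); rewrite setTI.
  by congr measurable; apply/seteqP; split => x /=; rewrite in_itv.
rewrite negb_and -!leNgt => /orP[r0|rL].
  apply: (@multiplier_ae (fun=> 0) _ 1); first exact: multiplier_cst.
  - exact: measurable_indic.
  - by move=> x; rewrite normr0.
  - by move=> x; rewrite indicE; case: (_ \in _); rewrite ?normr1 ?normr0.
  apply: filterS (ae_box L) => x /(_ i); rewrite /= in_itv/= => /andP[x0 _].
  by rewrite indicE memNset//= ltNge (le_trans r0).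
apply: (@multiplier_ae (fun=> 1) _ 1); first exact: multiplier_cst.
- exact: measurable_indic.
- by move=> x; rewrite normr1.
- by move=> x; rewrite indicE; case: (_ \in _); rewrite ?normr1 ?normr0.
apply: filterS2 (ae_box L) (ae_coord_neq i (L i)) => x /(_ i).
rewrite /= in_itv/= => /andP[_ xL] xnL.
by rewrite indicE mem_set//= (lt_le_trans _ rL)// lt_neqAle xnL.
Qed.

Definition multiplier_set (A : set 'rV[R]_d) := measurable A /\ multiplier (\1_A).

Lemma multiplier_set0 : multiplier_set set0.
Proof.
split=> //; have := multiplier_cst 0; congr multiplier.
by apply: funext => x; rewrite indicE in_set0.
Qed.

Lemma multiplier_setC A : multiplier_set A -> multiplier_set (~` A).
Proof.
move=> [mA AM]; split; first exact: measurableC.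
have := multiplierB (multiplier_cst 1) AM; congr multiplier; apply: funext => x.
rewrite !indicE; have [Ax|Ax] := pselect (A x).
  by rewrite mem_set// memNset ?subrr//= => /(_ Ax).
by rewrite memNset// mem_set ?subr0.
Qed.

Lemma multiplier_setI A B : multiplier_set A -> multiplier_set B ->
  multiplier_set (A `&` B).
Proof.
move=> [mA AM] [mB BM]; split; first exact: measurableI.
by have := multiplierM AM BM; congr multiplier; apply: funext => x; rewrite indicI.
Qed.

Lemma multiplier_setU A B : multiplier_set A -> multiplier_set B ->
  multiplier_set (A `|` B).
Proof.
move=> AM BM; rewrite -[A]setCK -[B]setCK -setCI; apply: multiplier_setC.
by apply: multiplier_setI; exact: multiplier_setC.
Qed.

Lemma multiplier_set_bigcup (A : nat -> set 'rV[R]_d) :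
  (forall n, multiplier_set (A n)) -> multiplier_set (\bigcup_n A n).
Proof.
move=> AM; have mA : measurable (\bigcup_n A n).
  by apply: bigcup_measurable => n _; case: (AM n).
split=> //; pose F n := \big[setU/set0]_(k < n) A k.
have FM n : multiplier_set (F n).
  rewrite /F; elim: n => [|n IHn]; last first.
    by rewrite big_ord_recr; exact: multiplier_setU.
  by rewrite big_ord0; exact: multiplier_set0.
apply: (@multiplier_lim (fun n => \1_(F n)) _ 1).
- by move=> n; case: (FM n).
- by move=> n x; rewrite indicE; case: (_ \in _); rewrite ?normr1 ?normr0.
- exact: measurable_indic.
- by move=> x; rewrite indicE; case: (_ \in _); rewrite ?normr1 ?normr0.
apply: aeW => x; have [[N _ ANx]|nAx] := pselect ((\bigcup_n A n) x).
  apply: cvg_near_cst; exists N.+1 => // n /= Nn; rewrite !indicE !mem_set//.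
    by exists N.
  by rewrite /F -bigcup_mkord; exists N.
apply: cvg_near_cst; apply: nearW => n; rewrite !indicE !memNset//.
by rewrite /F -bigcup_mkord => -[k _ Akx]; apply: nAx; exists k.
Qed.

Lemma multiplier_measurable (A : set 'rV[R]_d) : measurable A -> multiplier_set A.
Proof.
have sigma_alg : sigma_algebra setT multiplier_set.
  split => [|B|F FM]; first exact: multiplier_set0.
    by rewrite setTD; exact: multiplier_setC.
  exact: multiplier_set_bigcup.
apply: smallest_sub => //; rewrite -bigcup_seq => B [i _] [C mC <-]; rewrite setTI.
(* A second induction over a generated sigma-algebra: Borel sets of the line are generated by open
   left rays, and preimages by a coordinate commute with complements and unions. *)
have : (@RGenInftyO.G R).-sigma.-measurable C by rewrite -RGenInftyO.measurableE.
move: C {mC}; apply: smallest_sub.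
  split => [|C CM|F FM].
  - by rewrite /= preimage_set0; exact: multiplier_set0.
  - by rewrite /= setTD preimage_setC; exact: multiplier_setC.
  - by rewrite /= preimage_bigcup; exact: multiplier_set_bigcup.
move=> _ [r ->].
rewrite /= (_ : _ @^-1` _ = [set x : 'rV[R]_d | x ord0 i < r]).
  split; last exact: multiplier_ray.
  have := measurable_coord i measurableT (measurable_itv `]-oo, r[); rewrite setTI.
  by congr measurable; apply/seteqP; split => x /=; rewrite in_itv.
by apply/seteqP; split => x /=; rewrite in_itv.
Qed.

(** Indicators are multipliers, so testing [u] times an indicator against the constant wave gives
    zero integral over every measurable set. *)
Lemma annihilated_eq0 u : annihilated u -> {ae mu, forall x, u x = 0}.
Proof.
move=> uA; have ui := annihilated_intg uA.
have := @integral_ae_eq _ _ _ mu setT measurableT (cst 0%E) (EFin \o u) ui (measurable_cst _).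
move=> h; have {h} : ae_eq mu setT (EFin \o u) (cst 0%E).
  apply: h => E _ mE; rewrite integral0.
  have [_ [_ _ /(_ u uA)[uEi /(_ 0 0)]]] := multiplier_measurable mE.
  under eq_Rintegral do rewrite /wave phase0 addr0 cos0 mulr1.
  move=> uE0; rewrite integral_mkcond.
  rewrite -[RHS](_ : (\int[mu]_x (u x * \1_E x)%:E)%E = _).
    apply: eq_integral => x _; rewrite patchE indicE /=.
    by case: (x \in E); rewrite ?mulr1 ?mulr0.
  by rewrite -[LHS]fineK ?(integrable_fin_num measurableT uEi)//; congr EFin.
by apply: filterS => x /= /(_ Logic.I) [].
Qed.

Lemma hart_complete u : intg u ->
  (forall k, ip mu u (hart L k) = 0) -> {ae mu, forall x, u x = 0}.
Proof.
move=> ui u0; apply: annihilated_eq0; split=> // k s.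
have uh j : intg (fun x => u x * hart L j x).
  apply: (@intgM_bounded _ _ _ _ _ _ 2) => //; last exact: hart_le2.
  by apply: continuous_rV_measurable; exact: continuous_hart.
(* [hart k] and [hart (- k)] have half-sum cos and half-difference sin of the phase, hence span all
   shifted waves of frequency [k]. *)
have -> : \int[mu]_x (u x * wave k s x) = \int[mu]_x
    ((cos s - sin s) / 2 * (u x * hart L k x) + (cos s + sin s) / 2 * (u x * hart L (- k) x)).
  apply: eq_Rintegral => x _; rewrite /wave /hart phaseN cosN sinN cosD.
  by field.
rewrite RintegralD//; [|exact: intgZ..].
by rewrite !RintegralZl// -!/(ip mu u (hart L _)) !u0 !mulr0 addr0.
Qed.

End completeness.

(** * Hartley series *)

Lemma ler_sum_uniq_sub (R : realType) (I : eqType) (s t : seq I) (F : I -> R) :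
  uniq s -> uniq t -> {subset s <= t} -> (forall i, 0 <= F i) ->
  \sum_(i <- s) F i <= \sum_(i <- t) F i.
Proof.
move=> us ut st F0; rewrite [leRHS](bigID (mem s))/= -[\sum_(i <- t | _ \in _) _]big_filter.
rewrite [X in X + _](perm_big s) /=; first by rewrite lerDl sumr_ge0.
apply: uniq_perm; rewrite ?filter_uniq// => i; rewrite mem_filter.
by apply/andP/idP => [[]//|/[dup] /st -> ->].
Qed.

Section cube.
Context {d : nat}.
Local Notation J := {ffun 'I_d -> int}.

(** The frequencies with all |k_i| <= N. They are enumerated by shifted finite functions so that
    sums of products over a cube factor coordinatewise. *)
Definition cube (N : nat) : seq J :=
  [seq [ffun i => (f i : nat)%:Z - N%:Z] | f : {ffun 'I_d -> 'I_(N.*2.+1)} <- enum predT].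

Lemma mem_cube N k : (k \in cube N) = [forall i, (`|k i| <= N)%N].
Proof.
apply/mapP/forallP => [[f _ ->] i|kN].
  by rewrite ffunE; case: (f i) => m mN /=; lia.
exists [ffun i => inord (absz (k i + N%:Z)%R)]; first by rewrite mem_enum.
apply/ffunP => i; rewrite !ffunE inordK; last by have := kN i; lia.
by have := kN i; lia.
Qed.

Lemma cube_uniq N : uniq (cube N).
Proof.
rewrite map_inj_uniq ?enum_uniq// => f g /ffunP fg; apply/ffunP => i.
by have := fg i; rewrite !ffunE => /addIr[/val_inj].
Qed.

Lemma cube_sub m n : (m <= n)%N -> {subset cube m <= cube n}.
Proof.
move=> mn k; rewrite !mem_cube => /forallP km; apply/forallP => i.
exact: leq_trans (km i) mn.
Qed.

Lemma cube_cover k : exists N, k \in cube N.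
Proof.
exists (\max_i `|k i|)%N; rewrite mem_cube; apply/forallP => i.
exact: (leq_bigmax (F := fun i => `|k i|%N)).
Qed.

Lemma cube_opp N : perm_eq (map -%R (cube N)) (cube N).
Proof.
apply: uniq_perm; [by rewrite (map_inj_uniq oppr_inj) cube_uniq|exact: cube_uniq|].
move=> k; rewrite -[k in LHS]opprK (mem_map oppr_inj) !mem_cube.
by apply: eq_forallb => i; rewrite ffunE abszN.
Qed.

End cube.

Section hartley_series.
Context {R : realType} {d : nat}.
Variable L : 'I_d -> R.
Hypothesis L0 : forall i, 0 < L i.
Local Notation mu := (box_measure L).
Local Notation ip := (ip mu).
Local Notation sqi u := (u \in Lfun mu 2%:E).
Local Notation J := {ffun 'I_d -> int}.
Local Notation hart := (hart L).
Implicit Types (u v : 'rV[R]_d -> R) (z : J -> R).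

Definition vol : R := \prod_(i < d) L i.
Local Notation V := vol.

(* The basis is not normalized: [hart k] has squared norm [vol]. *)
Definition hat u k := ip u (hart k).

(** Square summability over the whole lattice: the terms are nonnegative and the cubes exhaust
    it. *)
Definition ell2 z := exists B, forall N, \sum_(k <- cube N) z k ^+ 2 <= B.

Definition hsum N z (x : 'rV[R]_d) := V^-1 * \sum_(k <- cube N) z k * hart k x.

Lemma vol_gt0 : 0 < V. Proof. by apply: prodr_gt0 => i _; exact: L0. Qed.

Lemma sqi_hsum N z : sqi (hsum N z).
Proof. by apply: sqiZ; apply: sqi_sum => k; apply: sqiZ; exact: sqi_hart. Qed.

Lemma ip_hsuml N z v : sqi v ->
  ip (hsum N z) v = V^-1 * \sum_(k <- cube N) z k * hat v k.
Proof.
move=> vi; have zi k : sqi (fun x => z k * hart k x) by apply: sqiZ; exact: sqi_hart.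
rewrite ipZl//; last exact: sqi_sum.
congr (_ * _); rewrite ip_suml//; apply: eq_bigr => k _.
by rewrite ipZl ?[ip _ v]ipC//; exact: sqi_hart.
Qed.

Lemma hat_hsum N z j : hat (hsum N z) j = if j \in cube N then z j else 0.
Proof.
rewrite /hat ip_hsuml; last exact: sqi_hart.
under eq_bigr do rewrite /hat ip_hart//.
case: ifPn => [jN|jN].
  rewrite (bigD1_seq j) ?cube_uniq//= eqxx [\sum_(_ <- _ | _) _]big1 => [|k kj].
    by rewrite addr0 mulrC mulfK// gt_eqF// vol_gt0.
  by rewrite eq_sym (negbTE kj) mulr0.
rewrite big_seq [\sum_(_ <- _ | _) _]big1 ?mulr0// => k kN; case: eqP => [jk|]; last by rewrite mulr0.
by move: jN; rewrite jk kN.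
Qed.

Lemma ip_hsum m n z : (m <= n)%N ->
  ip (hsum m z) (hsum n z) = V^-1 * \sum_(k <- cube m) z k ^+ 2.
Proof.
move=> mn; rewrite ip_hsuml; last exact: sqi_hsum.
congr (_ * _); rewrite !big_seq; apply: eq_bigr => k km.
by rewrite hat_hsum (cube_sub mn)// expr2.
Qed.

(** The squared distance from [u] to its partial sum is nonnegative; expand it. *)
Lemma bessel u N : sqi u -> \sum_(k <- cube N) hat u k ^+ 2 <= V * ip u u.
Proof.
move=> ui; have := ip_ge0 mu (fun x => u x - hsum N (hat u) x).
rewrite ipBB//; last exact: sqi_hsum.
rewrite (ipC mu u) ip_hsuml// ip_hsum//.
under eq_bigr do rewrite -expr2.
set a := V^-1 * _ => h.
have : a <= ip u u by lra.
by rewrite /a ler_pdivrMl ?vol_gt0.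
Qed.

Lemma ell2_hat u : sqi u -> ell2 (hat u).
Proof. by move=> ui; exists (V * ip u u) => N; exact: bessel. Qed.

(** By orthogonality the squared distance of two partial sums is, up to 1/V, a difference of terms
    of a bounded monotone, hence convergent, real sequence. *)
Lemma ell2_cauchy z : ell2 z -> forall e, 0 < e -> exists N, forall m n,
  (N <= m)%N -> (N <= n)%N ->
  ip (fun x => hsum m z x - hsum n z x) (fun x => hsum m z x - hsum n z x) <= e.
Proof.
move=> [B zB] e e0; pose a N := \sum_(k <- cube N) z k ^+ 2.
have a_nd : nondecreasing_seq a.
  move=> m n mn; apply: (ler_sum_uniq_sub _ _ (cube_sub mn)) => [||k].
  - exact: cube_uniq.
  - exact: cube_uniq.
  - exact: sqr_ge0.
have : cvgn a.
  by apply: nondecreasing_is_cvgn => //; exists B => _ [n _ <-]; exact: zB.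
move=> /cvg_ex[l /cvgrPdist_lt /(_ (e * V / 2))].
rewrite !mulr_gt0 ?vol_gt0// => /(_ isT)[N _ aN].
have key m n : (N <= m)%N -> (m <= n)%N ->
    ip (fun x => hsum m z x - hsum n z x) (fun x => hsum m z x - hsum n z x) <= e.
  move=> Nm mn; rewrite ipBB; [|exact: sqi_hsum..].
  rewrite !ip_hsum// -!/(a _).
  have := aN m Nm; have := aN n (leq_trans Nm mn).
  rewrite /= !ltr_norml => /andP[h1 h2] /andP[h3 h4].
  have -> : V^-1 * a m - 2 * (V^-1 * a m) + V^-1 * a n = V^-1 * (a n - a m) by ring.
  by rewrite ler_pdivrMl ?vol_gt0//; lra.
exists N => m n Nm Nn; have [mn|/ltnW nm] := leqP m n; first exact: key.
apply: le_trans (key n m Nn nm); rewrite le_eqVlt; apply/orP; left; apply/eqP.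
by apply: eq_Rintegral => x _; ring.
Qed.

(** A coefficient is continuous in mean square by Cauchy-Schwarz, and that of the partial sum is
    exactly [z k] once the cube contains [k]. The tolerance e / V offsets the squared norm V of
    [hart k]. *)
Lemma hat_lim z u : sqi u ->
  (forall e, 0 < e -> exists N, forall n, (N <= n)%N ->
     ip (fun x => hsum n z x - u x) (fun x => hsum n z x - u x) <= e) ->
  hat u =1 z.
Proof.
move=> ui zu k; apply/eqP; rewrite eq_sym -subr_eq0 -sqrf_eq0; apply/eqP.
apply/le_anti; rewrite sqr_ge0 andbT; apply/ler_addgt0Pl => e e0; rewrite addr0.
have [N NP] := zu (e / V) (divr_gt0 e0 vol_gt0); have [M kM] := cube_cover k.
have di := sqiB (sqi_hsum (N + M) z) ui.
have := cauchy_schwarz di (sqi_hart L k).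
rewrite ip_hart// eqxx ipBl//; [|exact: sqi_hsum|exact: sqi_hart].
rewrite -/(hat _ k) -/(hat u k) hat_hsum (cube_sub (leq_addl N M))//.
move=> /le_trans; apply; rewrite -ler_pdivlMr ?vol_gt0//.
by apply: NP; rewrite leq_addr.
Qed.

Lemma synthesis z : ell2 z -> exists u, [/\ sqi u, hat u =1 z &
  forall e, 0 < e -> exists N, forall n, (N <= n)%N ->
     ip (fun x => hsum n z x - u x) (fun x => hsum n z x - u x) <= e].
Proof.
move=> zl; have [u ui zu] := sqi_complete (fun N => sqi_hsum N z) (ell2_cauchy zl).
by exists u; split=> //; exact: hat_lim.
Qed.

Lemma hat_inj u v : sqi u -> sqi v -> hat u =1 hat v -> u = v %[ae mu].
Proof.
move=> ui vi uv; have := @hart_complete _ _ _ L0 (fun x => u x - v x).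
move=> /(_ (sqi_intg (sqiB ui vi))) h.
have {h} : {ae mu, forall x, u x - v x = 0}.
  apply: h => k; rewrite ipBl//; last exact: sqi_hart.
  by rewrite -/(hat u k) -/(hat v k) uv subrr.
by apply: filterS => x /eqP; rewrite subr_eq0 => /eqP.
Qed.

(** The series converges to some [v] with the coefficients of [u]; completeness of the system
    identifies [v] with [u]. *)
Lemma hsum_hat_cvg u : sqi u -> forall e, 0 < e ->
  exists N, forall n, (N <= n)%N ->
     ip (fun x => hsum n (hat u) x - u x) (fun x => hsum n (hat u) x - u x) <= e.
Proof.
move=> ui e e0; have [v [vi vu /(_ e e0)[N NP]]] := synthesis (ell2_hat ui).
exists N => n /NP; apply: le_trans; rewrite le_eqVlt; apply/orP; left; apply/eqP.
have uv := hat_inj ui vi (fun k => esym (vu k)).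
have [ui' vi'] := (sqiB (sqi_hsum n (hat u)) ui, sqiB (sqi_hsum n (hat u)) vi).
have uv' : (fun x => hsum n (hat u) x - u x) = (fun x => hsum n (hat u) x - v x) %[ae mu].
  by apply: filterS uv => x /= + xT => ->.
by rewrite (ip_ae ui' vi' ui' uv') ipC (ip_ae ui' vi' vi' uv').
Qed.

Lemma parseval u v : sqi u -> sqi v ->
  V^-1 * \sum_(k <- cube n) hat u k * hat v k @[n --> \oo] --> ip u v.
Proof.
move=> ui vi; apply/cvgrPdist_le => e e0.
(* The tolerance is e^2 / (|v|^2 + 1), as required by Cauchy-Schwarz; the 1 covers v = 0. *)
have [N NP] := hsum_hat_cvg ui (divr_gt0 (exprn_gt0 2 e0) (ltr_wpDl (ip_ge0 mu v) ltr01)).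
exists N => // n /= /NP h; rewrite -ip_hsuml//.
rewrite -ler_sqr ?nnegrE//; last exact: ltW.
rewrite -normrX ger0_norm ?sqr_ge0// -sqrrN opprB -ipBl//; last exact: sqi_hsum.
apply: le_trans (cauchy_schwarz (sqiB (sqi_hsum n _) ui) vi) _.
apply: le_trans (_ : _ <= e ^+ 2 / (ip v v + 1) * ip v v) _.
  by rewrite ler_wpM2r ?ip_ge0.
rewrite mulrAC ler_pdivrMr; last by rewrite ltr_wpDl// ip_ge0.
by rewrite ler_pM2l ?exprn_gt0// lerDl.
Qed.

End hartley_series.

(** * Weak derivatives and Hartley coefficients *)

Section ell2_theory.
Context {R : realType} {d : nat}.
Local Notation J := {ffun 'I_d -> int}.
Implicit Types z : J -> R.

Lemma ell2_ext z1 z2 : z1 =1 z2 -> ell2 z1 -> ell2 z2.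
Proof. by move=> /funext ->. Qed.

Lemma ell2_le c z1 z2 : (forall k, `|z2 k| <= c * `|z1 k|) -> ell2 z1 -> ell2 z2.
Proof.
move=> zc [B zB]; exists (c ^+ 2 * B) => N.
apply: (@le_trans _ _ (c ^+ 2 * \sum_(k <- cube N) z1 k ^+ 2)); last first.
  by rewrite ler_wpM2l ?sqr_ge0.
rewrite mulr_sumr; apply: ler_sum => k _.
rewrite -exprMn -[X in X <= _]ger0_norm ?sqr_ge0// normrX.
rewrite -[X in _ <= X]ger0_norm ?sqr_ge0// normrX ler_sqr ?nnegrE// normrM.
by apply: le_trans (zc k) _; rewrite ler_wpM2r// ler_norm.
Qed.

Lemma ell2Z c z : ell2 z -> ell2 (fun k => c * z k).
Proof. by apply: (@ell2_le `|c|) => k; rewrite normrM. Qed.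

Lemma ell2D z1 z2 : ell2 z1 -> ell2 z2 -> ell2 (fun k => z1 k + z2 k).
Proof.
move=> [B1 h1] [B2 h2]; exists (2 * B1 + 2 * B2) => N.
apply: (@le_trans _ _ (2 * \sum_(k <- cube N) z1 k ^+ 2 + 2 * \sum_(k <- cube N) z2 k ^+ 2)).
  rewrite !mulr_sumr -big_split; apply: ler_sum => k _ /=.
  by have := sqr_ge0 (z1 k - z2 k); nra.
by rewrite lerD// ler_wpM2l.
Qed.

Lemma ell2B z1 z2 : ell2 z1 -> ell2 z2 -> ell2 (fun k => z1 k - z2 k).
Proof.
move=> h1 /(ell2Z (-1)) h2; have := ell2D h1 h2.
by apply: ell2_ext => k; rewrite mulN1r.
Qed.

Lemma sum_cube_opp N (F : J -> R) :
  \sum_(k <- cube N) F (- k) = \sum_(k <- cube N) F k.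
Proof.
transitivity (\sum_(k <- map -%R (cube N)) F k); first by rewrite [RHS]big_map.
exact: perm_big (cube_opp N).
Qed.

End ell2_theory.

Section weak_derivatives.
Context {R : realType} {d : nat}.
Variable L : 'I_d -> R.
Hypothesis L0 : forall i, 0 < L i.
Local Notation mu := (box_measure L).
Local Notation ip := (ip mu).
Local Notation sqi u := (u \in Lfun mu 2%:E).
Local Notation J := {ffun 'I_d -> int}.
Local Notation hart := (hart L).
Local Notation hat := (hat L).
Local Notation freq := (freq L).
Local Notation ebase i := (delta_mx ord0 i : 'rV[R]_d).
Implicit Types (u v g eta : 'rV[R]_d -> R) (z : J -> R) (s : seq 'I_d).

Lemma hatD u v k : sqi u -> sqi v -> hat (fun x => u x + v x) k = hat u k + hat v k.
Proof. by move=> ui vi; apply: ipDl => //; exact: sqi_hart. Qed.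

Lemma hatZ c u k : sqi u -> hat (fun x => c * u x) k = c * hat u k.
Proof. by move=> ui; apply: ipZl => //; exact: sqi_hart. Qed.

Lemma hatB u v k : sqi u -> sqi v -> hat (fun x => u x - v x) k = hat u k - hat v k.
Proof. by move=> ui vi; apply: ipBl => //; exact: sqi_hart. Qed.

Lemma hat_sum (F : 'I_d -> 'rV[R]_d -> R) k : (forall i, sqi (F i)) ->
  hat (fun x => \sum_(i < d) F i x) k = \sum_(i < d) hat (F i) k.
Proof. by move=> Fi; apply: ip_suml => //; exact: sqi_hart. Qed.

Lemma hat_ae u v k : sqi u -> sqi v -> u = v %[ae mu] -> hat u k = hat v k.
Proof. by move=> ui vi uv; apply: ip_ae => //; exact: sqi_hart. Qed.

(** Each derivative sends [hart k] to a multiple of [hart (- k)], so the resulting frequency depends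
    on the parity of the order only; [dcoef] collects the factors. *)
Definition sgk s k : J := if odd (size s) then - k else k.

Fixpoint dcoef s k : R :=
  if s is i :: s' then dcoef s' k * freq (sgk s' k) i else 1.

Lemma sgkK s : involutive (sgk s).
Proof. by move=> k; rewrite /sgk; case: (odd _) => /=; rewrite ?opprK. Qed.

Lemma freq_sgk s k i : freq (sgk s k) i = (-1) ^+ size s * freq k i.
Proof.
by rewrite /sgk -signr_odd; case: odd; rewrite ?freqN ?mulN1r ?mul1r.
Qed.

Lemma dcoefN s k : dcoef s (- k) = (-1) ^+ size s * dcoef s k.
Proof.
elim: s => [|i s IHs]; first by rewrite mul1r.
by rewrite /= IHs !freq_sgk freqN exprS; ring.
Qed.

Lemma dcoef_sgk s k : dcoef s (sgk s k) = (-1) ^+ size s * dcoef s k.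
Proof.
rewrite /sgk -signr_odd; case: ifP => [os|_]; last by rewrite mul1r.
by rewrite dcoefN -signr_odd os.
Qed.

Lemma partials_hart s k :
  partials s (hart k) = fun x => dcoef s k * hart (sgk s k) x.
Proof.
elim: s => [|i s IHs]; first by apply: funext => x; rewrite mul1r.
rewrite -[LHS]/('D_(ebase i) (partials s (hart k))) IHs; apply: funext => x.
rewrite (_ : (fun x => _) = dcoef s k *: hart (sgk s k)); last by [].
rewrite deriveZ; last exact: (derive_hart L (sgk s k) i x).1.
rewrite (derive_hart L (sgk s k) i x).2 /= /GRing.scale /= mulrA.
by congr (_ * hart _ _); rewrite /sgk /=; case: odd => //=; rewrite opprK.
Qed.

Lemma smooth_hart k : smooth (hart k).
Proof.
move=> s x; rewrite partials_hart.
rewrite (_ : (fun x => _) = dcoef s k *: hart (sgk s k)); last by [].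
by apply: differentiableZ; exact: differentiable_hart.
Qed.

Lemma continuous_partials s eta : smooth eta -> continuous (partials s eta).
Proof. by move=> seta x; exact: differentiable_continuous (seta s x). Qed.

Lemma sqi_partials s eta : smooth eta -> sqi (partials s eta).
Proof. by move=> seta; apply: sqi_continuous; exact: continuous_partials. Qed.

Lemma periodic_partials s eta : smooth eta -> Defs.periodic L eta ->
  Defs.periodic L (partials s eta).
Proof.
move=> seta peta; elim: s => [//|i s IHs] j x.
rewrite -[LHS]/('D_(ebase i) (partials s eta) (x + L j *: ebase j)).
rewrite -[RHS]/('D_(ebase i) (partials s eta) x).
have [_ <-] := @derive_comp_affine R _ _ _ (partials s eta)
  (fun y => y + L j *: ebase j) x (ebase i) (ebase i) (fun h => esym (addrA _ _ _)).
by congr ('D_(ebase i) _ x); apply: funext => y /=; exact: IHs.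
Qed.

Lemma ip_hart_partials s k eta : smooth eta -> Defs.periodic L eta ->
  ip (hart k) (partials s eta) =
  (-1) ^+ size s * dcoef s k * ip (hart (sgk s k)) eta.
Proof.
move=> seta peta; elim: s k => [|i s IHs] k; first by rewrite !mul1r.
rewrite -[partials _ _]/('D_(ebase i) (partials s eta)) ip_derive//.
- rewrite (_ : 'D_(ebase i) (hart k) = fun x => freq k i * hart (- k) x); last first.
    by apply: funext => x; exact: (derive_hart L k i x).2.
  rewrite ipZl ?IHs; [|exact: sqi_hart|exact: sqi_partials].
  rewrite (_ : sgk s (- k) = sgk (i :: s) k); last first.
    by rewrite /sgk /=; case: odd => //=; rewrite opprK.
  by rewrite /= dcoefN freq_sgk exprS; ring.
- exact: differentiable_hart.
- rewrite (_ : 'D_(ebase i) (hart k) = fun x => freq k i * hart (- k) x); last first.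
    by apply: funext => x; exact: (derive_hart L k i x).2.
  by apply: continuous_scale; exact: continuous_hart.
- exact: (@continuous_partials (i :: s) eta seta).
- exact: periodic_hart.
- exact: periodic_partials.
Qed.

(** One direction tests against the smooth periodic function [hart k]. For the other, Parseval
    expands both integrals, and the coefficients of the derivatives of [eta] come from classical
    integration by parts. *)
Lemma is_weak_derivP s u g : sqi u -> sqi g ->
  is_weak_deriv L s u g <->
  forall k, hat g k = (-1) ^+ size s * dcoef s k * hat u (sgk s k).
Proof.
move=> ui gi; split=> [wd k|gE eta seta peta].
  have /(_ (smooth_hart k) (periodic_hart L0 k)) := wd (hart k).
  rewrite partials_hart -/(ip u _) -/(ip g _) -/(hat g k) [ip u _]ipC.
  rewrite ipZl//; last exact: sqi_hart.
  rewrite ipC -/(hat u _) => h.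
  by rewrite -mulrA h mulrA -exprMn mulrNN mulr1 expr1n mul1r.
rewrite -/(ip u (partials s eta)) -/(ip g eta).
have etai : sqi eta by exact: (sqi_partials [::]).
have h1 := parseval L0 ui (sqi_partials s seta).
have h2 := parseval L0 gi etai.
apply: (cvg_unique _ h1) => //.
rewrite (_ : (fun n => _) = (fun n => (-1) ^+ size s *
    ((vol L)^-1 * \sum_(k <- cube n) hat g k * hat eta k))).
  by apply: cvgMr; exact: h2.
apply: funext => n; rewrite mulrCA; congr (_ * _); rewrite mulr_sumr.
(* Cubes are symmetric, so the change of sign of the frequency is a reindexing. *)
have sgk_sum (F : J -> R) : \sum_(k <- cube n) F (sgk s k) = \sum_(k <- cube n) F k.
  by rewrite /sgk; case: odd => //; exact: sum_cube_opp.
rewrite -[RHS]sgk_sum; apply: eq_bigr => k _.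
rewrite gE sgkK dcoef_sgk /hat [ip (partials _ _) _]ipC ip_hart_partials//.
rewrite [ip eta _]ipC.
have sgn : (-1) ^+ size s * (-1) ^+ size s = 1 :> R.
  by rewrite -exprMn mulrNN mulr1 expr1n.
by rewrite -[LHS]mul1r -[X in X * _ = _]sgn; ring.
Qed.

Lemma weak_derivP s u : (exists2 g, L2 L g & is_weak_deriv L s u g) ->
  L2 L (weak_deriv L s u) /\ is_weak_deriv L s u (weak_deriv L s u).
Proof.
move=> [g gi gw].
exact: (@getPex _ [set g | L2 L g /\ is_weak_deriv L s u g] (ex_intro _ g (conj gi gw))).
Qed.

Lemma hat_weak_deriv n s u k : Hper L n u -> (size s <= n)%N ->
  hat (weak_deriv L s u) k = (-1) ^+ size s * dcoef s k * hat u (sgk s k).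
Proof.
move=> [ui uw] /uw/weak_derivP[wi ww]; exact: (is_weak_derivP s ui wi).1 ww k.
Qed.

Lemma sqi_weak_deriv n s u : Hper L n u -> (size s <= n)%N -> sqi (weak_deriv L s u).
Proof. by move=> [ui uw] /uw/weak_derivP[wi ww]. Qed.

(** The eigenvalue of -Delta on [hart k]. *)
Definition lam k : R := \sum_(i < d) freq k i ^+ 2.

Lemma lam_ge0 k : 0 <= lam k.
Proof. by apply: sumr_ge0 => i _; exact: sqr_ge0. Qed.

Lemma lamN k : lam (- k) = lam k.
Proof. by apply: eq_bigr => i _; rewrite freqN sqrrN. Qed.

Lemma lam_sgk s k : lam (sgk s k) = lam k.
Proof. by rewrite /sgk; case: ifP => //; rewrite lamN. Qed.

Lemma Hper_leq m n u : (m <= n)%N -> Hper L n u -> Hper L m u.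
Proof. by move=> mn [ui uw]; split=> // s sm; apply: uw; exact: leq_trans sm mn. Qed.

Lemma sqi_lap u : Hper L 2 u -> sqi (lap L u).
Proof. by move=> uH; apply: sqi_sum => i; exact: (sqi_weak_deriv uH). Qed.

Lemma hat_lap u k : Hper L 2 u -> hat (lap L u) k = - lam k * hat u k.
Proof.
move=> uH; rewrite /lap hat_sum; last by move=> i; exact: (sqi_weak_deriv uH).
rewrite /lam -sumrN mulr_suml; apply: eq_bigr => i _.
by rewrite (hat_weak_deriv k uH)//= !freq_sgk /sgk /=; ring.
Qed.

Lemma dcoef_bound s k : dcoef s k ^+ 2 <= (1 + lam k) ^+ size s.
Proof.
elim: s => [|i s IHs]; first by rewrite expr1n.
rewrite /= exprMn [leRHS]exprS [leLHS]mulrC ler_pM ?sqr_ge0//.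
rewrite -(lam_sgk s) /lam (bigD1 i)//= addrCA lerDl.
by rewrite addr_ge0// sumr_ge0// => j _; exact: sqr_ge0.
Qed.

(** The candidate coefficients of each derivative of order at most 2m are dominated by the given
    sequence, since |[dcoef s k]| <= (1 + lam k)^m; synthesis then produces the derivative. *)
Lemma Hper_ell2 m u : sqi u -> ell2 (fun k => (1 + lam k) ^+ m * hat u k) ->
  Hper L m.*2 u.
Proof.
move=> ui uell; split=> // s sm.
have [|g [gi gE _]] :=
    synthesis L0 (z := fun k => (-1) ^+ size s * dcoef s k * hat u (sgk s k)).
  have sell : ell2 (fun k => (1 + lam k) ^+ m * hat u (sgk s k)).
    have [B uB] := uell; exists B => N; rewrite /sgk; case: odd; last exact: uB.
    apply: le_trans (uB N); rewrite -[leRHS]sum_cube_opp.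
    by apply: ler_sum => k _; rewrite lamN.
  apply: (@ell2_le _ _ 1) sell => k; rewrite mul1r !normrM normrX normrN1 expr1n mul1r.
  rewrite ler_wpM2r//.
  have lam1 : 1 <= 1 + lam k by rewrite lerDl lam_ge0.
  rewrite [leRHS]ger0_norm; last by rewrite exprn_ge0// (le_trans ler01).
  rewrite -ler_sqr ?nnegrE//; last by rewrite exprn_ge0// (le_trans ler01).
  rewrite -normrX ger0_norm ?sqr_ge0//; apply: le_trans (dcoef_bound s k) _.
  by rewrite -exprM muln2 ler_weXn2l.
by exists g => //; apply/is_weak_derivP.
Qed.

Lemma Hper2_ell2 u : Hper L 2 u -> ell2 (fun k => (1 + lam k) * hat u k).
Proof.
move=> uH; have ui := uH.1; have li := sqi_lap uH.
apply: ell2_ext (ell2B (ell2_hat L0 ui) (ell2_hat L0 li)) => k.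
by rewrite hat_lap//; ring.
Qed.

Lemma Hper2P u : sqi u -> ell2 (fun k => (1 + lam k) * hat u k) -> Hper L 2 u.
Proof. by move=> ui; exact: (@Hper_ell2 1). Qed.

Lemma sqi_lap1 u : Hper L 2 u -> sqi (lap1 L u).
Proof. by move=> uH; apply: sqiD; [exact: sqi_lap|exact: uH.1]. Qed.

Lemma hat_lap1 u k : Hper L 2 u -> hat (lap1 L u) k = (1 - lam k) * hat u k.
Proof.
move=> uH; rewrite hatD; [|exact: sqi_lap|exact: uH.1].
by rewrite hat_lap//; ring.
Qed.

(** On coefficients (1 + lam)(1 - lam) = 1 - lam^2, and lam^2 is the symbol of the bilaplacian, a
    sum of fourth-order weak derivatives of [u]. *)
Lemma Hper_lap1 u : Hper L 4 u -> Hper L 2 (lap1 L u).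
Proof.
move=> uH; have uH2 := Hper_leq (isT : (2 <= 4)%N) uH.
apply: Hper2P; first exact: sqi_lap1.
pose b x := \sum_(i < d) \sum_(j < d) weak_deriv L [:: i; i; j; j] u x.
have wi i j : sqi (weak_deriv L [:: i; i; j; j] u) by exact: (sqi_weak_deriv uH).
have bi : sqi b by apply: sqi_sum => i; exact: sqi_sum.
apply: ell2_ext (ell2B (ell2_hat L0 uH.1) (ell2_hat L0 bi)) => k.
rewrite hat_lap1// hat_sum; last by move=> i; exact: sqi_sum.
rewrite (_ : \sum_(i < d) _ = lam k ^+ 2 * hat u k); first by ring.
rewrite expr2 {1}/lam !mulr_suml; apply: eq_bigr => i _.
rewrite hat_sum// /lam mulr_sumr mulr_suml; apply: eq_bigr => j _.
by rewrite (hat_weak_deriv k uH)//= !freq_sgk /sgk/=; ring.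
Qed.

End weak_derivatives.

(** * Sobolev embedding *)

Section summable_weights.
Context {R : realType}.

(** The cube root makes the fourth power the summable weight (n + 1)^(-4/3), and also gives a
    telescoping majorant of it. *)
Definition cbrtV (n : nat) : R := n.+1%:R `^ (- 3^-1).

Lemma cbrtV_gt0 n : 0 < cbrtV n. Proof. by rewrite powR_gt0. Qed.

Lemma cbrtVX3 n : cbrtV n ^+ 3 = n.+1%:R^-1.
Proof.
rewrite -powR_mulrn ?powR_ge0// -powRrM mulNr mulVf//.
by rewrite powR_inv1.
Qed.

(** Let x >= y be the two values. From 1/(n+1) - 1/(n+2) = 1/((n+1)(n+2)) one has x^3 - y^3 = x^3
    y^3, while x^3 - y^3 <= 3 x^2 (x - y). Hence y^4 <= x y^3 <= 3 (x - y). *)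
Lemma cbrtV_telescope n : cbrtV n.+1 ^+ 4 <= 3 * (cbrtV n - cbrtV n.+1).
Proof.
have [x0 y0] := (cbrtV_gt0 n, cbrtV_gt0 n.+1).
have [x3 y3] := (cbrtVX3 n, cbrtVX3 n.+1).
have n0 : (0 : R) < n.+1%:R by []. have n1 : (0 : R) < n.+2%:R by [].
have : cbrtV n ^+ 3 - cbrtV n.+1 ^+ 3 = cbrtV n ^+ 3 * cbrtV n.+1 ^+ 3.
  by rewrite x3 y3 -[n.+2%:R]natr1; field; rewrite !gt_eqF// natr1.
move: x0 y0 {x3 y3}; move: (cbrtV n) (cbrtV n.+1) => x y x0 y0 xy.
have yx : y <= x.
  have : y ^+ 3 <= x ^+ 3 by rewrite -subr_ge0 xy mulr_ge0// exprn_ge0// ltW.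
  by rewrite ler_pXn2r// nnegrE ltW.
have fact : x ^+ 3 - y ^+ 3 <= (x - y) * (3 * x ^+ 2).
  rewrite (_ : x ^+ 3 - y ^+ 3 = (x - y) * (x ^+ 2 + x * y + y ^+ 2)); last by ring.
  rewrite ler_wpM2l ?subr_ge0//.
  have : x * y <= x ^+ 2 by rewrite expr2 ler_wpM2l// ltW.
  have : y ^+ 2 <= x ^+ 2 by rewrite ler_sqr ?nnegrE// ltW.
  by lra.
rewrite xy in fact.
have : x * y ^+ 3 <= 3 * (x - y).
  rewrite -(ler_pM2r (exprn_gt0 2 x0)); apply: le_trans (_ : _ <= (x - y) * (3 * x ^+ 2)) _.
    by apply: le_trans fact; rewrite le_eqVlt; apply/orP; left; apply/eqP; ring.
  by rewrite le_eqVlt; apply/orP; left; apply/eqP; ring.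
by apply: le_trans; rewrite exprS ler_wpM2r// exprn_ge0// ltW.
Qed.

Lemma sum_cbrtV N : \sum_(n < N) cbrtV n ^+ 4 <= 4.
Proof.
case: N => [|N]; first by rewrite big_ord0.
have c0 : cbrtV 0 = 1 by rewrite /cbrtV powR1.
suff : \sum_(n < N.+1) cbrtV n ^+ 4 <= 1 + 3 * (cbrtV 0 - cbrtV N).
  by have := cbrtV_gt0 N; rewrite c0; lra.
elim: N => [|N IHN]; first by rewrite big_ord1 subrr mulr0 addr0 c0 expr1n.
rewrite big_ord_recr /=; have := cbrtV_telescope N; lra.
Qed.

Lemma sum_cbrtV_centered N :
  \sum_(j < N.*2.+1) cbrtV `|(j : nat)%:Z - N%:Z| ^+ 4 <= 8.
Proof.
have -> : N.*2.+1 = (N.+1 + N)%N by lia.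
rewrite big_split_ord /= [X in X + _](reindex_inj rev_ord_inj) /=.
apply: le_trans (_ : _ <= 4 + 4) _; last by lra.
apply: lerD.
  apply: le_trans (sum_cbrtV N.+1); apply: ler_sum => j _.
  by rewrite (_ : absz _ = j)//; have := ltn_ord j; lia.
apply: le_trans (_ : _ <= \sum_(n < N.+1) cbrtV n ^+ 4) _; last exact: sum_cbrtV.
rewrite big_ord_recl -[leLHS]add0r; apply: lerD.
  by rewrite exprn_ge0// ltW// cbrtV_gt0.
apply: ler_sum => j _; rewrite (_ : absz _ = j.+1)//.
by rewrite /=; lia.
Qed.

End summable_weights.

Section sobolev.
Context {R : realType} {d : nat}.
Variable L : 'I_d -> R.
Hypothesis L0 : forall i, 0 < L i.
Hypothesis d3 : (d <= 3)%N.
Local Notation mu := (box_measure L).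
Local Notation ip := (ip mu).
Local Notation sqi u := (u \in Lfun mu 2%:E).
Local Notation J := {ffun 'I_d -> int}.
Local Notation hart := (hart L).
Local Notation hat := (hat L).
Local Notation lam := (lam L).
Local Notation omega i := (pi *+ 2 / L i).
Implicit Types (u v : 'rV[R]_d -> R).

(** The square of the constant K in (1 + |m|)^2 <= K (1 + omega^2 m^2). *)
Let C i : R := (2 * (1 + (omega i) ^- 2)) ^+ 2.

Lemma omega_gt0 i : 0 < omega i.
Proof. by rewrite divr_gt0// mulrn_wgt0// pi_gt0. Qed.

Lemma weight1_bound i (m : int) :
  (1 + (omega i * m%:~R) ^+ 2) ^- 2 <= (C i * cbrtV `|m| ^+ 4) ^+ 3.
Proof.
have w0 := omega_gt0 i; rewrite /C; set w := omega i.
set n : R := `|m|%N.+1%:R; have n0 : 0 < n by [].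
have mE : (m%:~R : R) ^+ 2 = `|m|%N%:R ^+ 2.
  by rewrite -[LHS]ger0_norm ?sqr_ge0// normrX -intr_norm natr_absz.
have nE : n = `|m|%N%:R + 1 by rewrite natr1.
set a := `|m|%N%:R in mE nE; have a0 : (0 : R) <= a by [].
set K : R := 2 * (1 + w ^- 2).
have iw : 0 < w ^- 2 by rewrite invr_gt0 exprn_gt0.
have K2 : 1 <= K by rewrite /K; lra.
have key : n ^+ 2 <= K * (1 + (w * m%:~R) ^+ 2).
  rewrite exprMn mE nE (_ : K * _ = 2 * (1 + w ^- 2 + w ^+ 2 * a ^+ 2 + a ^+ 2)); last first.
    by rewrite /K; field; rewrite gt_eqF.
  have : 0 <= w ^+ 2 * a ^+ 2 by rewrite mulr_ge0// ?exprn_ge0// ltW.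
  by have := sqr_ge0 (a - 1); nra.
set p := 1 + (w * m%:~R) ^+ 2; rewrite -/p in key.
have p0 : 0 < p by rewrite /p ltr_pwDl// sqr_ge0.
have c43 : (cbrtV `|m| ^+ 4) ^+ 3 = n ^- 4 :> R.
  by rewrite -exprM mulnC exprM cbrtVX3 exprVn.
rewrite exprMn c43.
rewrite ler_pdivlMr ?exprn_gt0// mulrC ler_pdivrMr ?exprn_gt0//.
have -> : n ^+ 4 = (n ^+ 2) ^+ 2 by ring.
apply: le_trans (_ : _ <= (K * p) ^+ 2) _.
  have Kp0 : 0 <= K * p by rewrite mulr_ge0 ?(ltW p0)// (le_trans ler01).
  by rewrite ler_sqr ?nnegrE ?sqr_ge0.
(* Only K^2 is needed in front of p^2; K >= 1 allows its cube, which fits the cubed weight. *)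
rewrite exprMn ler_wpM2r ?sqr_ge0// -[leLHS]expr1 ler_weXn2l//.
by rewrite exprn_ege1.
Qed.

(* For [d <= 3]: [(1 + lam)^6 >= prod_i (1 + freq_i^2)^2], and the cube root of
   the right-hand side grows like [prod_i |k_i|^(4/3)]. *)
Lemma weight_bound (k : J) :
  (1 + lam k) ^- 2 <= \prod_(i < d) (C i * cbrtV `|k i| ^+ 4).
Proof.
have C0 i : 0 <= C i by rewrite sqr_ge0.
have h0 i : 0 <= C i * cbrtV `|k i| ^+ 4.
  by rewrite mulr_ge0// exprn_ge0// ltW// cbrtV_gt0.
have lam1 : 1 <= 1 + lam k by rewrite lerDl lam_ge0.
have lam0 : 0 < 1 + lam k by rewrite (lt_le_trans ltr01).
rewrite -(@ler_pXn2r _ 3)// ?nnegrE ?invr_ge0 ?exprn_ge0 ?(ltW lam0) ?prodr_ge0//.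
rewrite -prodrXl.
apply: le_trans (_ : _ <= \prod_(i < d) (1 + freq L k i ^+ 2) ^- 2) _; last first.
  apply: ler_prod => i _; rewrite invr_ge0 exprn_ge0 ?addr_ge0 ?sqr_ge0//=.
  exact: weight1_bound.
rewrite prodfV prodrXl exprVn lef_pV2 ?posrE; last 2 first.
- by rewrite !exprn_gt0.
- by rewrite exprn_gt0// prodr_gt0// => i _; rewrite ltr_pwDl ?sqr_ge0.
rewrite -exprM mulnC exprM ler_sqr ?nnegrE ?exprn_ge0 ?(ltW lam0)//; last first.
  by apply: prodr_ge0 => i _; rewrite addr_ge0 ?sqr_ge0.
apply: le_trans (_ : _ <= (1 + lam k) ^+ d) _; last exact: ler_weXn2l.
rewrite -[X in _ ^+ X]card_ord -prodr_const; apply: ler_prod => i _.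
rewrite addr_ge0 ?sqr_ge0//= lerD2l /lam (bigD1 i)//= lerDl.
by apply: sumr_ge0 => j _; exact: sqr_ge0.
Qed.

Lemma summable_weights : exists W, forall N,
  \sum_(k <- cube N) (1 + lam k) ^- 2 <= W.
Proof.
exists (\prod_(i < d) (C i * 8)) => N.
apply: le_trans (_ : _ <= \sum_(k <- cube N) \prod_(i < d) (C i * cbrtV `|k i| ^+ 4)) _.
  by apply: ler_sum => k _; exact: weight_bound.
rewrite big_map big_enum /=.
under eq_bigr do under eq_bigr do rewrite ffunE.
(* The sum over the cube becomes a product of one-dimensional sums. *)
rewrite -(bigA_distr_bigA (fun i (j : 'I_(N.*2.+1)) =>
  C i * cbrtV `|(j : nat)%:Z - N%:Z| ^+ 4)).
apply: ler_prod => i _; rewrite -mulr_sumr; apply/andP; split.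
  rewrite mulr_ge0 ?sqr_ge0// sumr_ge0// => j _.
  by rewrite exprn_ge0// ltW// cbrtV_gt0.
by rewrite ler_wpM2l ?sqr_ge0// sum_cbrtV_centered.
Qed.

(** |z| is the product of (1 + lam) |z| and 1 / (1 + lam), hence at most the sum of their squares,
    both summable; the factor 2 bounds [hart]. *)
Lemma hsum_bounded z : ell2 (fun k => (1 + lam k) * z k) ->
  exists K, forall N x, `|hsum L N z x| <= K.
Proof.
move=> [B zB]; have [W lW] := summable_weights.
exists ((vol L)^-1 * ((B + W) * 2)) => N x.
have V0 := vol_gt0 L0.
rewrite /hsum normrM gtr0_norm ?invr_gt0// ler_pM2l ?invr_gt0//.
apply: le_trans (ler_norm_sum _ _ _) _.
apply: le_trans (_ : _ <= \sum_(k <- cube N)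
    ((((1 + lam k) * z k) ^+ 2 + (1 + lam k) ^- 2) * 2)) _; last first.
  by rewrite -mulr_suml big_split ler_wpM2r// lerD.
apply: ler_sum => k _; rewrite normrM ler_pM//; last exact: hart_le2.
have lam0 : 0 < 1 + lam k by rewrite (lt_le_trans ltr01)// lerDl lam_ge0.
have -> : ((1 + lam k) * z k) ^+ 2 = ((1 + lam k) * `|z k|) ^+ 2.
  by rewrite !exprMn -[in RHS]normrX [in RHS]ger0_norm ?sqr_ge0.
rewrite -exprVn; have := sqr_ge0 ((1 + lam k) * `|z k| - (1 + lam k)^-1).
have E : (1 + lam k) * `|z k| * (1 + lam k)^-1 = `|z k| by rewrite mulrAC mulfV ?mul1r// gt_eqF.
have := normr_ge0 (z k).
rewrite sqrrB E; lra.
Qed.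

(* Sobolev embedding: the partial Hartley sums of [u] are uniformly bounded, and
   they converge to [u] in mean square. *)
Lemma Hper2_bounded u : Hper L 2 u -> exists K, {ae mu, forall x, `|u x| <= K}.
Proof.
move=> uH; have ui : sqi u := uH.1.
have [K hK] := hsum_bounded (Hper2_ell2 L0 uH); exists K.
(* The excess of |u| over K is pointwise at most the distance from [u] to any partial sum, so its
   L^2 norm is 0. *)
pose p x := Num.max (`|u x| - K) 0.
have mu_ := sqi_measurable ui.
have mp : measurable_fun setT p.
  apply: measurable_maxr => //; apply: measurable_funB => //.
  exact: measurableT_comp.
have p0 x : 0 <= p x by rewrite /p le_max lexx orbT.
have p_le n x : p x ^+ 2 <= (hsum L n (hat u) x - u x) ^+ 2.
  rewrite -[leRHS]ger0_norm ?sqr_ge0// normrX ler_sqr ?nnegrE//.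
  rewrite /p ge_max normr_ge0 andbT distrC.
  by have := ler_normB (u x) (hsum L n (hat u) x); have := hK n x;
     have := ler_dist_dist (u x) (hsum L n (hat u) x); rewrite ler_norml => /andP[_]; lra.
have di n := sqiB (sqi_hsum L n (hat u)) ui.
have pi_ : sqi p.
  apply/sqiP; split=> //; apply: intg_le (sqi_sqr (di 0)).
    exact: measurable_funX.
  by move=> x; rewrite ger0_norm ?sqr_ge0.
have : ip p p = 0.
  apply/le_anti; rewrite ip_ge0 andbT; apply/ler_addgt0Pl => e e0; rewrite addr0.
  have [N NP] := hsum_hat_cvg L0 ui e0; apply: le_trans (NP N (leqnn N)).
  apply: le_Rintegral => //; try exact: sqi_mul.
  by move=> x _; rewrite -!expr2.
move=> /(ip_eq0 pi_); apply: filterS => x; rewrite /p => /eqP.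
by rewrite eq_maxr ?subr_le0//; case: leP => // _ /eqP; lra.
Qed.

End sobolev.

(** * The scheme *)

Lemma ell2_norm (R : realType) d (z : {ffun 'I_d -> int} -> R) :
  ell2 z -> ell2 (fun k => `|z k|).
Proof. by apply: (@ell2_le _ _ 1) => k; rewrite mul1r normr_id. Qed.

Section linear_step.
Context {R : realType} {d : nat}.
Variable L : 'I_d -> R.
Hypothesis L0 : forall i, 0 < L i.
Local Notation mu := (box_measure L).
Local Notation sqi u := (u \in Lfun mu 2%:E).
Local Notation J := {ffun 'I_d -> int}.
Local Notation hat := (hat L).
Local Notation lam := (lam L).
Implicit Types (u v w g : 'rV[R]_d -> R) (k : J).

Lemma sqi_lin a b u v : sqi u -> sqi v -> sqi (fun x => a * u x + b * v x).
Proof. by move=> ui vi; apply: sqiD; exact: sqiZ. Qed.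

Lemma hat_lin a b u v k : sqi u -> sqi v ->
  hat (fun x => a * u x + b * v x) k = a * hat u k + b * hat v k.
Proof. by move=> ui vi; rewrite hatD ?hatZ//; exact: sqiZ. Qed.

Lemma Hper2_lin a b u v : Hper L 2 u -> Hper L 2 v ->
  Hper L 2 (fun x => a * u x + b * v x).
Proof.
move=> uH vH; apply: Hper2P => //; first exact: sqi_lin uH.1 vH.1.
have := ell2D (ell2Z a (Hper2_ell2 L0 uH)) (ell2Z b (Hper2_ell2 L0 vH)).
by apply: ell2_ext => k; rewrite hat_lin ?uH.1 ?vH.1//; ring.
Qed.

(** The Sobolev embedding enters here: the essential bound on [u] controls the cubic term. *)
Lemma sqi_nonlinearity (eps hvac c : R) u : (d <= 3)%N -> Hper L 2 u ->
  sqi (fun x => c * (fpot eps (u x) + fvac hvac (u x))).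
Proof.
move=> d3 uH; have [K uK] := Hper2_bounded L0 d3 uH.
have mu_ := sqi_measurable uH.1; apply: sqiZ.
apply: (@sqi_ae_bounded _ _ _ _ _ (K ^+ 3 + `|eps| * K + `|hvac| * (K + K) * K)).
  apply: measurable_funD.
    by apply: measurable_funB; [exact: measurable_funX|exact: measurable_funM].
  apply: measurable_funM => //; apply: measurable_funM => //.
  by apply: measurable_funB => //; exact: measurableT_comp.
apply: filterS uK => x; move: (u x) => y yK.
apply: le_trans (ler_normD _ _) (lerD _ _).
  apply: le_trans (ler_normB _ _) (lerD _ _).
    by rewrite normrX lerXn2r ?nnegrE// (le_trans _ yK).
  by rewrite normrM ler_wpM2l.
have K0 : 0 <= K by exact: le_trans yK.
rewrite !normrM ler_pM// ?mulr_ge0// ler_wpM2l//.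
by apply: le_trans (ler_normB _ _) _; rewrite normr_id lerD.
Qed.

Lemma lam_eq0 k : lam k = 0 -> k = 0.
Proof.
move=> /eqP; rewrite psumr_eq0 => [/allP k0|i _]; last exact: sqr_ge0.
apply/ffunP => i; rewrite ffunE; have := k0 i (mem_index_enum i).
rewrite sqrf_eq0 /freq mulf_eq0 (negbTE (lt0r_neq0 (omega_gt0 L0 i))) /=.
by rewrite intr_eq0 => /eqP.
Qed.

Lemma lam0 : lam 0 = 0.
Proof. by apply: big1 => i _; rewrite /freq ffunE mulr0 expr0n. Qed.

(** The spectral gap: a nonzero integer frequency has some |k_i| >= 1, so lam k >= omega_i^2. The
    sum of all omega_i^-2 serves every i at once. *)
Lemma lam_gap : exists2 G : R, 0 <= G & forall k, lam k != 0 -> 1 <= lam k * G.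
Proof.
exists (\sum_(i < d) (pi *+ 2 / L i) ^- 2).
  by apply: sumr_ge0 => i _; rewrite invr_ge0 sqr_ge0.
move=> k lk; have [i ki] : exists i, k i != 0.
  apply/existsP; move: lk; apply: contraR; rewrite negb_exists => /forallP k0.
  rewrite (_ : k = 0) ?lam0//; apply/ffunP => i; rewrite ffunE.
  by apply/eqP; have := k0 i; rewrite negbK.
have w0 := omega_gt0 L0 i.
apply: (@le_trans _ _ ((pi *+ 2 / L i) ^+ 2 * (pi *+ 2 / L i) ^- 2)).
  by rewrite mulfV// expf_neq0// gt_eqF.
apply: ler_pM; rewrite ?invr_ge0 ?sqr_ge0//.
  rewrite /lam (bigD1 i)//= -[leLHS]addr0 lerD ?sumr_ge0//; last first.
    by move=> j _; exact: sqr_ge0.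
  rewrite /freq; move: (pi *+ 2 / L i) => W; rewrite exprMn ler_peMr ?sqr_ge0//.
  rewrite -[leRHS]ger0_norm ?sqr_ge0// normrX exprn_ege1//.
  by rewrite -intr_norm ler1z -gtz0_ge1 normr_gt0.
rewrite (bigD1 i)//= lerDl sumr_ge0// => j _.
by rewrite invr_ge0 sqr_ge0.
Qed.

Lemma hat0 u : hat u 0 = \int[mu]_x u x.
Proof. by apply: eq_Rintegral => x _; rewrite hart0 mulr1. Qed.

Variables (M alpha beta S dt : R).
Hypotheses (M0 : 0 < M) (alpha0 : 0 <= alpha) (beta0 : 0 <= beta)
  (S0 : 0 < S) (dt0 : 0 < dt).

Definition chem_potential w g (r : 'rV[R]_d -> R) : 'rV[R]_d -> R :=
  fun x => lap1 L (lap1 L w) x + g x + S * r x.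

Lemma sqi_chem_potential w g r : Hper L 4 w -> sqi g -> sqi r ->
  sqi (chem_potential w g r).
Proof.
move=> wH gi ri; apply: sqiD; last exact: sqiZ.
by apply: sqiD => //; apply: sqi_lap1; exact: Hper_lap1.
Qed.

Lemma hat_chem_potential w g r k : Hper L 4 w -> sqi g -> sqi r ->
  hat (chem_potential w g r) k =
  (1 - lam k) ^+ 2 * hat w k + hat g k + S * hat r k.
Proof.
move=> wH gi ri; have lH := Hper_lap1 L0 wH.
have lli : sqi (lap1 L (lap1 L w)) by exact: sqi_lap1.
rewrite hatD ?hatZ//; [|exact: sqiD|exact: sqiZ].
rewrite hatD// !hat_lap1//; last exact: Hper_leq wH.
by rewrite expr2; ring.
Qed.

(** The stabilization compensates the zero of (1 - l)^2 at l = 1. From (l - 3)^2 >= 0 follows (1 +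
    l)^2 <= 2 (1 - l)^2 + 8, and the minimum is chosen so that 2 c <= 1 and 8 c <= 2 S. *)
Lemma symbol_bound (l : R) : 0 <= l ->
  Num.min 2^-1 (S / 4) * (1 + l) ^+ 2 <= (1 - l) ^+ 2 + 2 * S.
Proof.
move=> l0; set c := Num.min _ _.
have c1 : c <= 2^-1 by rewrite /c ge_min lexx.
have c2 : c <= S / 4 by rewrite /c ge_min lexx orbT.
have c0 : 0 < c by rewrite /c lt_min invr_gt0 divr_gt0 // ltr0n.
apply: (@le_trans _ _ (c * (2 * (1 - l) ^+ 2 + 8))).
  by rewrite ler_wpM2l ?(ltW c0)//; have := sqr_ge0 (l - 3); nra.
rewrite mulrDr lerD//; last by lra.
by rewrite mulrA -[leRHS]mul1r ler_wpM2r ?sqr_ge0//; lra.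
Qed.

(* The mean mode is treated apart: [D] vanishes there when [alpha = beta = 0]. *)
Lemma linear_step_solution u1 v1 r1 g :
  sqi u1 -> sqi v1 -> sqi r1 -> sqi g -> \int[mu]_x v1 x = 0 ->
  exists w, [/\ Hper L 4 w, hat w 0 = hat u1 0,
    Hper L 2 (chem_potential w g (fun x => 2 * w x - u1 x - r1 x)) &
    forall k, (2 * alpha / dt + beta) * (2 / dt * (hat w k - hat u1 k))
                - 2 * alpha / dt * hat v1 k =
      - M * lam k * hat (chem_potential w g (fun x => 2 * w x - u1 x - r1 x)) k].
Proof.
move=> ui vi ri gi v0; set q := 2 * alpha / dt + beta.
have q0 : 0 <= q by rewrite addr_ge0// divr_ge0 ?mulr_ge0// ltW.
have qd0 : 0 <= 2 * q / dt by rewrite divr_ge0 ?mulr_ge0// ltW.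
pose D l := 2 * q / dt + M * l * ((1 - l) ^+ 2 + 2 * S).
pose G k := hat g k - S * (hat u1 k + hat r1 k).
pose num k := 2 * q / dt * hat u1 k + 2 * alpha / dt * hat v1 k - M * lam k * G k.
(* Keeping the mean of [u1] gives the half-step psi, a multiple of w - u1, zero mean. *)
pose z k := if lam k == 0 then hat u1 k else num k / D (lam k).
have Dpos k : lam k != 0 -> 0 < D (lam k).
  move=> lk; have l0 : 0 < lam k by rewrite lt_neqAle eq_sym lk lam_ge0.
  by rewrite ltr_wpDl// !mulr_gt0// ltr_wpDl ?sqr_ge0// mulr_gt0.
have [H H0 HP] := lam_gap.
have [uE vE rE gE] := And4 (ell2_hat L0 ui) (ell2_hat L0 vi) (ell2_hat L0 ri)
  (ell2_hat L0 gi).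
pose c := Num.min 2^-1 (S / 4).
have c0 : 0 < c by rewrite /c lt_min invr_gt0 divr_gt0 // ltr0n.
pose A k := 2 * q / dt * hat u1 k + 2 * alpha / dt * hat v1 k.
have AE : ell2 A by apply: ell2D; exact: ell2Z.
have GE : ell2 G by apply: ell2B => //; apply: ell2Z; exact: ell2D.
have zell : ell2 (fun k => (1 + lam k) ^+ 2 * z k).
  (* The first term covers the mean mode. In [num], the part [A] has no factor lam and costs the gap
     constant [H]; in the other part lam cancels against the lower bound of [D]. *)
  have dom : ell2 (fun k => `|hat u1 k| + (H / (M * c) * `|A k| + c^-1 * `|G k|)).
    by apply: ell2D; [|apply: ell2D; apply: ell2Z]; exact: ell2_norm.
  apply: (@ell2_le _ _ 1) dom => k; rewrite mul1r [leRHS]ger0_norm; last first.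
    by rewrite !addr_ge0// !mulr_ge0// ?invr_ge0 ?mulr_ge0// ltW.
  rewrite /z; case: ifPn => [/eqP ->|lk].
    rewrite addr0 expr1n mul1r lerDl addr_ge0// mulr_ge0//.
      by rewrite divr_ge0// mulr_ge0// ltW.
    by rewrite invr_ge0 ltW.
  apply: le_trans (_ : _ <= H / (M * c) * `|A k| + c^-1 * `|G k|) _; last by rewrite lerDr.
  have l0 : 0 < lam k by rewrite lt_neqAle eq_sym lk lam_ge0.
  have s0 : 0 < (1 + lam k) ^+ 2 by rewrite exprn_gt0// ltr_wpDl.
  have DM : M * lam k * c * (1 + lam k) ^+ 2 <= D (lam k).
    rewrite /D -[leLHS]add0r lerD// -[leLHS]mulrA ler_wpM2l ?mulr_ge0 ?(ltW M0) ?(ltW l0)//.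
    exact: symbol_bound (ltW l0).
  have numE : `|num k| <= `|A k| + M * lam k * `|G k|.
    apply: le_trans (ler_normB _ _) _; rewrite lerD2l normrM.
    by rewrite [`|M * _|]gtr0_norm ?mulr_gt0.
  rewrite normrM [`|num k / _|]normrM [`|(D _)^-1|]gtr0_norm ?invr_gt0 ?Dpos//.
  rewrite [`|(1 + _) ^+ 2|]gtr0_norm//.
  rewrite mulrA ler_pdivrMr ?Dpos//.
  apply: le_trans (_ : _ <= (H / (M * c) * `|A k| + c^-1 * `|G k|) *
    (M * lam k * c * (1 + lam k) ^+ 2)) _; last first.
    by rewrite ler_wpM2l// addr_ge0// mulr_ge0// ?divr_ge0 ?invr_ge0 ?mulr_ge0// ltW.
  rewrite mulrA [leLHS]mulrC ler_wpM2r ?(ltW s0)//.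
  apply: le_trans numE _; rewrite (_ : _ * (M * lam k * c) =
    lam k * H * `|A k| + M * lam k * `|G k|); last by field; rewrite !gt_eqF.
  by rewrite lerD2r ler_peMl// HP.
have [|w [wi wE _]] := synthesis L0 (z := z).
  apply: (@ell2_le _ _ 1) zell => k; rewrite mul1r normrM ler_peMl//.
  by rewrite ger0_norm ?sqr_ge0// exprn_ege1// lerDl lam_ge0.
have wH : Hper L 4 w.
  by apply: (@Hper_ell2 _ _ _ L0 2) => //; apply: ell2_ext zell => k; rewrite wE.
set r := fun x => 2 * w x - u1 x - r1 x.
have r_i : sqi r by apply: sqiB => //; apply: sqiB => //; exact: sqiZ.
have hr k : hat r k = 2 * z k - hat u1 k - hat r1 k.
  by rewrite !hatB ?hatZ ?wE//; [exact: sqiZ|apply: sqiB => //; exact: sqiZ].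
have ci := sqi_chem_potential wH gi r_i.
have eqk k : q * (2 / dt * (hat w k - hat u1 k)) - 2 * alpha / dt * hat v1 k =
    - M * lam k * hat (chem_potential w g r) k.
  rewrite hat_chem_potential// hr wE /z; case: ifPn => [/eqP lk|lk].
    (* On the mean mode both sides vanish, because [v1] has zero mean. *)
    rewrite lk (lam_eq0 lk) subrr hat0 v0; ring.
  have : num k / D (lam k) * D (lam k) = num k by rewrite divfK// gt_eqF// Dpos.
  move: (num k / D (lam k)) => y; rewrite /num /D /G => yD.
  apply/eqP; rewrite -subr_eq0; apply/eqP.
  transitivity (y * (2 * q / dt + M * lam k * ((1 - lam k) ^+ 2 + 2 * S)) -
    (2 * q / dt * hat u1 k + 2 * alpha / dt * hat v1 k -
     M * lam k * (hat g k - S * (hat u1 k + hat r1 k)))); first by ring.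
  by rewrite yD subrr.
exists w; split=> //.
- by rewrite wE /z lam0 eqxx.
- apply: Hper2P => //.
  (* The H^2 regularity of the potential is read off the equation: M lam [ch] = - [E] with [E]
     square summable, and the gap upgrades lam to 1 + lam. *)
  set ch := hat (chem_potential w g r).
  pose E k := q * (2 / dt * (hat w k - hat u1 k)) - 2 * alpha / dt * hat v1 k.
  have EE : ell2 E.
    apply: ell2B; last exact: ell2Z.
    by do 2 apply: ell2Z; apply: ell2B => //; exact: ell2_hat.
  have dom : ell2 (fun k => `|ch k| + (1 + H) / M * `|E k|).
    by apply: ell2D; [|apply: ell2Z]; apply: ell2_norm => //; exact: ell2_hat.
  apply: (@ell2_le _ _ 1) dom => k; rewrite mul1r [leRHS]ger0_norm; last first.
    by rewrite addr_ge0// mulr_ge0// divr_ge0 ?addr_ge0// ltW.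
  have [->|lk] := eqVneq (lam k) 0.
    by rewrite addr0 mul1r lerDl mulr_ge0// divr_ge0 ?addr_ge0// ltW.
  have l0 : 0 < lam k by rewrite lt_neqAle eq_sym lk lam_ge0.
  apply: le_trans (_ : _ <= (1 + H) / M * `|E k|) _; last by rewrite lerDr.
  rewrite /E eqk -/ch !normrM normrN (gtr0_norm M0) (gtr0_norm l0).
  rewrite gtr0_norm ?ltr_wpDl//.
  rewrite (_ : _ * (M * lam k * _) = (lam k * (1 + H)) * `|ch k|); last first.
    by field; rewrite gt_eqF.
  by rewrite ler_wpM2r// mulrDr mulr1 addrC lerD2l HP.
Qed.

End linear_step.

(** The sets handed to [get] for [u] and [v] are equal, so the same potential is chosen. *)
Lemma norm_m1_ae (R : realType) d (L : 'I_d -> R) (u v : 'rV[R]_d -> R) :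
  u = v %[ae box_measure L] -> norm_m1 L u = norm_m1 L v.
Proof.
move=> uv; rewrite /norm_m1; suff -> : neg_lap_inv L u = neg_lap_inv L v by [].
rewrite /neg_lap_inv; congr get; apply/seteqP; split => w /= [wH w0 lw]; split=> //.
- by apply: filterS2 lw uv => x h1 h2 xT; rewrite h1// h2.
- by apply: filterS2 lw uv => x h1 h2 xT; rewrite h1// h2.
Qed.

(** * The implicit update of the scalar variable *)

Section scalar_update.
Context {R : realType}.
Variables (M beta dt C : R).
Hypotheses (M0 : 0 < M) (beta0 : 0 <= beta) (dt0 : 0 < dt) (C0 : 0 < C).

Let den N := 1 + dt * (beta / (C * M) * N ^+ 2).

Let den_ge1 N : 1 <= den N.
Proof.
rewrite lerDl mulr_ge0 ?(ltW dt0)// mulr_ge0 ?sqr_ge0// divr_ge0//.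
by rewrite mulr_ge0// ltW.
Qed.

Lemma scalar_updateP (b1 b2 N : R) :
  (b2 - b1) / dt = - (beta * b2 / (C * M)) * N ^+ 2 <-> b2 = b1 / den N.
Proof.
have d0 : den N != 0 by rewrite gt_eqF// (lt_le_trans ltr01).
have E b : (b - b1) / dt + (beta * b / (C * M)) * N ^+ 2 = (b * den N - b1) / dt.
  by rewrite /den; field; rewrite !gt_eqF.
split=> [h|->].
  have : (b2 * den N - b1) / dt = 0 by rewrite -E h mulNr addNr.
  move=> /eqP; rewrite mulf_eq0 invr_eq0 (gt_eqF dt0) orbF subr_eq0 => /eqP <-.
  by rewrite mulfK.
by apply/eqP; rewrite mulNr -addr_eq0 E divfK// subrr mul0r.
Qed.

Lemma scalar_update_decr (b1 b2 N : R) : 0 < b1 ->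
  (b2 - b1) / dt = - (beta * b2 / (C * M)) * N ^+ 2 -> 0 < b2 <= b1.
Proof.
move=> b10 /scalar_updateP ->; have d1 := den_ge1 N.
have d0 : 0 < den N by rewrite (lt_le_trans ltr01).
by rewrite divr_gt0//= ler_pdivrMr// ler_peMr// ltW.
Qed.

End scalar_update.

Lemma ln_decr (R : realType) (C b1 b2 : R) : 0 < C -> 0 < b2 <= b1 ->
  C * ln b2 <= C * ln b1.
Proof.
move=> C0 /andP[b20 b21]; rewrite ler_pM2l// ler_ln// posrE//.
exact: lt_le_trans b21.
Qed.

(** * Existence, uniqueness and energy decay *)

Section scheme_solution.
Context {R : realType} {d : nat}.
Variables (L : 'I_d -> R) (M alpha beta eps hvac S dt C : R).
Hypotheses (d3 : (d <= 3)%N) (L0 : forall i, 0 < L i) (M0 : 0 < M)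
  (alpha0 : 0 <= alpha) (beta0 : 0 <= beta) (S0 : 0 < S) (dt0 : 0 < dt) (C0 : 0 < C).
Local Notation mu := (box_measure L).
Local Notation sqi u := (u \in Lfun mu 2%:E).
Local Notation hat := (hat L).
Local Notation lam := (lam L).
Local Notation step := (sesav_cn_step L M alpha beta eps hvac S dt C).

Lemma step_exists (a0 a1 : state R d) : admissible L a0 -> admissible L a1 ->
  exists a2, admissible L a2 /\ step a0 a1 a2.
Proof.
case: a0 a1 => [u0 v0 b0] [u1 v1 b1] [/= u0H [v0i I0]] [/= u1H [v1i I1]].
pose dag x := 3 / 2 * u1 x - 1 / 2 * u0 x.
pose star x := 2 * u1 x - u0 x.
have dagE : dag = fun x => 3 / 2 * u1 x + (- (1 / 2)) * u0 x.
  by apply: funext => x; rewrite mulNr.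
have starE : star = fun x => 2 * u1 x + (-1) * u0 x.
  by apply: funext => x; rewrite mulN1r.
have dagH : Hper L 2 dag by rewrite dagE; exact: Hper2_lin.
have stari : sqi star by rewrite starE; exact: sqi_lin u1H.1 u0H.1.
pose xi := (3 / 2 * b1 - 1 / 2 * b0) /
  expR (pseudo_energy L M alpha eps hvac dag (fun x => 3 / 2 * v1 x - 1 / 2 * v0 x) / C).
pose g x := xi * (fpot eps (dag x) + fvac hvac (dag x)).
have gi : sqi g by exact: sqi_nonlinearity.
have [w [wH w0 muH wE]] := linear_step_solution L0 M0 alpha0 beta0 S0 dt0
  u1H.1 v1i stari gi I1.
(* Undo the averages: phi^{n+1} = 2 w - phi^n, and psi^{n+1/2} = (phi^{n+1} - phi^n) / dt = 2 (w -
   phi^n) / dt. *)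
pose u2 x := 2 * w x - u1 x.
pose v2 x := 4 / dt * (w x - u1 x) - v1 x.
have wi : sqi w := wH.1.
have u2H : Hper L 2 u2.
  rewrite (_ : u2 = fun x => 2 * w x + (-1) * u1 x).
    by apply: Hper2_lin => //; exact: Hper_leq wH.
  by apply: funext => x; rewrite mulN1r.
have wu1 : sqi (fun x => w x - u1 x) by apply: sqiB => //; exact: u1H.1.
have v2i : sqi v2 by apply: sqiB => //; exact: sqiZ.
have halfE : (fun x => (u2 x + u1 x) / 2) = w.
  by apply: funext => x; rewrite /u2; field.
have vhalfE : (fun x => (v2 x + v1 x) / 2) = fun x => 2 / dt * (w x - u1 x).
  by apply: funext => x; rewrite /v2; field; rewrite gt_eqF.
pose N := norm_m1 L (fun x => (v2 x + v1 x) / 2).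
pose b2 := b1 / (1 + dt * (beta / (C * M) * N ^+ 2)).
exists (State u2 v2 b2); split.
  split=> //=; split=> //; rewrite -hat0 hatB//; last exact: sqiZ.
  rewrite hatZ// hatB//; last exact: u1H.1.
  by rewrite w0 subrr mulr0 hat0 I1 subr0.
have muE : (fun x => lap1 L (lap1 L (fun x => (u2 x + u1 x) / 2)) x + g x + S * (u2 x - star x))
    = chem_potential L S w g (fun x => 2 * w x - u1 x - star x).
  by rewrite halfE.
set ch := chem_potential _ _ _ _ _ in muH wE muE.
have lapi : sqi (lap L ch) by exact: sqi_lap.
have flowE : (fun x => alpha * ((v2 x - v1 x) / dt) + beta * ((v2 x + v1 x) / 2)) =
    fun x => (2 * alpha / dt + beta) * (2 / dt * (w x - u1 x)) + (- (2 * alpha / dt)) * v1 x.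
  by apply: funext => x; rewrite /v2; field; rewrite gt_eqF.
have flow_ae : {ae mu, forall x,
    alpha * ((v2 x - v1 x) / dt) + beta * ((v2 x + v1 x) / 2) = M * lap L ch x}.
  have wu1d : sqi (fun x => 2 / dt * (w x - u1 x)) by exact: sqiZ.
  pose p x := (2 * alpha / dt + beta) * (2 / dt * (w x - u1 x)) + (- (2 * alpha / dt)) * v1 x.
  (* The modewise identity becomes an equation almost everywhere by injectivity of the
     coefficients. *)
  have : p = (fun x => M * lap L ch x) %[ae mu].
    apply: (hat_inj L0) => [||k]; [exact: sqi_lin|exact: sqiZ|].
    rewrite hat_lin// !hatZ// hatB ?u1H.1// hat_lap// mulNr.
    by rewrite wE; ring.
  apply: filterS => x /(_ Logic.I) <-.
  exact: (congr1 (fun f => f x) flowE).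
rewrite /sesav_cn_step /=; split.
- by rewrite halfE.
- have muH' : Hper L 2 (fun x => lap1 L (lap1 L (fun x => (u2 x + u1 x) / 2)) x + g x + S * (u2 x - star x)).
    by rewrite muE.
  exact: muH'.
- have flow_ae' : {ae mu, forall x, alpha * ((v2 x - v1 x) / dt) + beta * ((v2 x + v1 x) / 2) =
      M * lap L (fun x => lap1 L (lap1 L (fun x => (u2 x + u1 x) / 2)) x + g x + S * (u2 x - star x)) x}.
    by rewrite muE.
  exact: flow_ae'.
- by apply: aeW => x; rewrite /v2 /u2; field; rewrite gt_eqF.
- exact/scalar_updateP.
Qed.

Definition explicit_term (a0 a1 : state R d) : 'rV[R]_d -> R :=
  let dag x := 3 / 2 * phi_of a1 x - 1 / 2 * phi_of a0 x in
  let xi := (3 / 2 * B_of a1 - 1 / 2 * B_of a0) / expR (pseudo_energy L M alpha eps hvac dag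
    (fun x => 3 / 2 * psi_of a1 x - 1 / 2 * psi_of a0 x) / C) in
  fun x => xi * (fpot eps (dag x) + fvac hvac (dag x)).

Lemma sqi_explicit_term a0 a1 : admissible L a0 -> admissible L a1 ->
  sqi (explicit_term a0 a1).
Proof.
move=> [u0H _] [u1H _]; apply: sqi_nonlinearity => //.
rewrite (_ : (fun x => _) = fun x => 3 / 2 * phi_of a1 x + (- (1 / 2)) * phi_of a0 x).
  exact: Hper2_lin.
by apply: funext => x; rewrite mulNr.
Qed.

(** The modewise linear system satisfied by any solution. The explicit term depends on [a0] and [a1]
    only and thus cancels in the difference of two solutions. *)
Lemma step_hat (a0 a1 a2 : state R d) k :
  admissible L a0 -> admissible L a1 -> admissible L a2 -> step a0 a1 a2 ->
  let phi b := hat (phi_of b) k in let psi b := hat (psi_of b) k in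
  2^-1 * psi a2 + 2^-1 * psi a1 = dt^-1 * phi a2 - dt^-1 * phi a1 /\
  alpha / dt * (psi a2 - psi a1) + beta * (2^-1 * psi a2 + 2^-1 * psi a1) =
  - M * lam k * ((1 - lam k) ^+ 2 * (2^-1 * phi a2 + 2^-1 * phi a1)
    + hat (explicit_term a0 a1) k + S * (phi a2 - (2 * phi a1 - phi a0))).
Proof.
move=> a0A a1A [u2H [v2i _]] [wH muH flow kin _] phi psi.
have gi := sqi_explicit_term a0A a1A.
case: a0A a1A => [u0H _] [u1H [v1i _]].
have [u0i [u1i u2i]] := (u0H.1, (u1H.1, u2H.1)).
set w := (fun x => (phi_of a2 x + phi_of a1 x) / 2) in wH.
have wE : w = fun x => 2^-1 * phi_of a2 x + 2^-1 * phi_of a1 x.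
  by apply: funext => x; rewrite /w; field.
pose star x := 2 * phi_of a1 x - phi_of a0 x.
have stari : sqi star by apply: sqiB => //; exact: sqiZ.
pose r x := phi_of a2 x - star x.
have ri : sqi r by exact: sqiB.
have muH' : Hper L 2 (chem_potential L S w (explicit_term a0 a1) r) by exact: muH.
have kinE : 2^-1 * psi a2 + 2^-1 * psi a1 = dt^-1 * phi a2 - dt^-1 * phi a1.
  rewrite -hat_lin// -!hatZ// -hatB; [|exact: sqiZ..].
  apply: hat_ae; [exact: sqi_lin|by apply: sqiB; exact: sqiZ|].
  apply: filterS kin => x kx _.
  transitivity ((psi_of a2 x + psi_of a1 x) / 2); first by field.
  by rewrite kx; ring.
split=> //.
have lapi : sqi (lap L (chem_potential L S w (explicit_term a0 a1) r)) by exact: sqi_lap.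
have := hat_lap L0 k muH'; rewrite hat_chem_potential//.
have -> : hat w k = 2^-1 * phi a2 + 2^-1 * phi a1 by rewrite wE hat_lin.
have hstar : hat star k = 2 * phi a1 - phi a0 by rewrite hatB ?hatZ//; exact: sqiZ.
rewrite hatB// hstar -/(phi a2) => lapE.
transitivity (M * hat (lap L (chem_potential L S w (explicit_term a0 a1) r)) k); last first.
  by rewrite lapE; ring.
rewrite -hatB// -hat_lin// -hat_lin//; [|exact: sqiB|exact: sqi_lin].
rewrite -hatZ//; apply: hat_ae; [|exact: sqiZ|].
  by apply: sqi_lin; [exact: sqiB|exact: sqi_lin].
have flow' : {ae mu, forall x, alpha * ((psi_of a2 x - psi_of a1 x) / dt)
  + beta * ((psi_of a2 x + psi_of a1 x) / 2) =
  M * lap L (chem_potential L S w (explicit_term a0 a1) r) x} by exact: flow.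
by apply: filterS flow' => x <- _; field; rewrite gt_eqF.
Qed.

Lemma step_unique (a0 a1 a2 b2 : state R d) :
  admissible L a0 -> admissible L a1 -> admissible L a2 -> admissible L b2 ->
  step a0 a1 a2 -> step a0 a1 b2 -> state_ae_eq L a2 b2.
Proof.
move=> a0A a1A a2A b2A sa sb.
have hatE k : hat (phi_of a2) k = hat (phi_of b2) k /\ hat (psi_of a2) k = hat (psi_of b2) k.
  have /= [ka fa] := step_hat k a0A a1A a2A sa.
  have /= [kb fb] := step_hat k a0A a1A b2A sb.
  pose X := hat (phi_of a2) k - hat (phi_of b2) k.
  pose Y := hat (psi_of a2) k - hat (psi_of b2) k.
  have YX : Y = 2 / dt * X.
    transitivity (2 * ((2^-1 * hat (psi_of a2) k + 2^-1 * hat (psi_of a1) k)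
      - (2^-1 * hat (psi_of b2) k + 2^-1 * hat (psi_of a1) k))).
      by rewrite /Y; field.
    by rewrite ka kb /X; ring.
  suff X0 : X = 0.
    by split; apply/eqP; rewrite -subr_eq0; apply/eqP; rewrite -?/Y ?YX ?X0 ?mulr0.
  (* On the mean mode the flow equation is void when alpha = beta = 0, so admissibility supplies Y =
     0. *)
  have [lk|lk] := eqVneq (lam k) 0.
    have : Y = 0.
      rewrite /Y (lam_eq0 L0 lk) !hat0.
      by case: a2A b2A => _ [_ ->] [_ [_ ->]]; rewrite subrr.
    by move=> /eqP; rewrite YX mulf_eq0 gt_eqF ?divr_gt0//= => /eqP.
  have l0 : 0 < lam k by rewrite lt_neqAle eq_sym lk lam_ge0.
  (* Half of the symbol used for existence, since X is a difference of values of phi^{n+1}, hence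
     twice one of w. *)
  pose D := 2 * alpha / dt ^+ 2 + beta / dt + M * lam k * ((1 - lam k) ^+ 2 / 2 + S).
  have D0 : 0 < D.
    rewrite /D ltr_wpDl ?mulr_gt0//.
      by rewrite addr_ge0// divr_ge0 ?mulr_ge0 ?exprn_ge0// ltW.
    by rewrite ltr_wpDl// divr_ge0// sqr_ge0.
  have : D * X = 0.
    have /eqP := congr2 (fun a b => a - b) fa fb; rewrite -subr_eq0 => /eqP <-.
    transitivity (alpha / dt * Y + beta / 2 * Y +
       M * lam k * ((1 - lam k) ^+ 2 / 2 * X + S * X)).
      by rewrite YX /D; field; rewrite gt_eqF.
    by rewrite /Y /X; field; rewrite gt_eqF.
  by move=> /eqP; rewrite mulf_eq0 (gt_eqF D0) => /eqP.
have phiE : phi_of a2 = phi_of b2 %[ae mu].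
  by apply: (hat_inj L0) => [||k]; [case: a2A => -[]|case: b2A => -[]|exact: (hatE k).1].
have psiE : psi_of a2 = psi_of b2 %[ae mu].
  by apply: (hat_inj L0) => [||k]; [case: a2A => _ []|case: b2A => _ []|exact: (hatE k).2].
split=> //; case: sa sb => [_ _ _ _ Ba] [_ _ _ _ Bb].
have normE : norm_m1 L (fun x => (psi_of a2 x + psi_of a1 x) / 2) =
    norm_m1 L (fun x => (psi_of b2 x + psi_of a1 x) / 2).
  by apply: norm_m1_ae; apply: filterS psiE => x /= + xT => ->.
move: Ba Bb; rewrite normE => /(scalar_updateP M0 beta0 dt0 C0) ->.
by move=> /(scalar_updateP M0 beta0 dt0 C0) ->.
Qed.

Lemma sequence_energy (phi0 : 'rV[R]_d -> R) (a : nat -> state R d) :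
  sesav_cn_sequence L M alpha beta eps hvac S dt C phi0 a ->
  forall n, 0 < B_of (a n.+1) /\ C * ln (B_of (a n.+1)) <= C * ln (B_of (a n)).
Proof.
move=> [a0E _ [_ _ _ _ first_B] steps].
(* The first-order scheme has the same scalar update, with psi^1 in place of the average; positivity
   starts from B^0, an exponential. *)
have B1 : 0 < B_of (a 1) <= B_of (a 0).
  by apply: (scalar_update_decr M0 beta0 dt0 C0 _ first_B); rewrite a0E expR_gt0.
have B n : 0 < B_of (a n.+1) <= B_of (a n).
  elim: n => [//|n /andP[IHn _]].
  have [_ _ _ _ Bn] := steps n.+1 isT.
  exact: (scalar_update_decr M0 beta0 dt0 C0 IHn Bn).
by move=> n; split; [case/andP: (B n)|exact: ln_decr].
Qed.

End scheme_solution.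

Theorem theorem3p6 (R : realType) (d : nat) (L : 'I_d -> R)
    (M alpha beta eps hvac S dt C : R) (phi0 : 'rV[R]_d -> R) :
  (1 <= d <= 3)%N -> (forall i, 0 < L i) ->
  0 < M -> 0 <= alpha -> 0 <= beta -> 0 < eps < 1 -> 0 <= hvac ->
  0 < S -> 0 < dt -> 0 < C ->
  Hper L 2 phi0 ->
  pseudo_energy L M alpha eps hvac phi0 (fun=> 0) <= C ->
  (forall a0 a1 : state R d, admissible L a0 -> admissible L a1 ->
     exists a2 : state R d,
       [/\ admissible L a2,
           sesav_cn_step L M alpha beta eps hvac S dt C a0 a1 a2
         & forall b2 : state R d, admissible L b2 ->
             sesav_cn_step L M alpha beta eps hvac S dt C a0 a1 b2 ->
             state_ae_eq L a2 b2])
  /\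
  (forall a : nat -> state R d,
     sesav_cn_sequence L M alpha beta eps hvac S dt C phi0 a ->
     forall n, 0 < B_of (a n.+1)
       /\ C * ln (B_of (a n.+1)) <= C * ln (B_of (a n))).
Proof.
move=> /andP[_ d3] L0 M0 alpha0 beta0 _ _ S0 dt0 C0 _ _; split.
  move=> a0 a1 a0A a1A.
  have [a2 [a2A a2S]] := step_exists eps hvac d3 L0 M0 alpha0 beta0 S0 dt0 C0 a0A a1A.
  exists a2; split=> // b2 b2A b2S.
  exact: (step_unique d3 L0 M0 alpha0 beta0 S0 dt0 C0 a0A a1A a2A b2A a2S b2S).
exact: sequence_energy.
Qed.
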